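(* Let $\gamma_1,\gamma_2>0$ be real numbers such that either $\gamma_1-\gamma_2-e(e+1)\geq \sqrt{2}\,e$ or $1-e(1+\gamma_1+\gamma_2)\geq \sqrt{2}$. If $p$ is an analytic function in $\mathbb{D}$ such that $p(0)=1$ and $$p(z)+\gamma_1 zp'(z)+\gamma_2 z^2p''(z)\prec z+\sqrt{1+z^2},$$ then $p(z)\prec e^z$.
   Context: $\mathbb{D}=\{z\in\mathbb{C}:|z|<1\}$ is the open unit disk. The square root is the principal branch, so that $\sqrt{1+z^2}$ is analytic on $\mathbb{D}$ with value $1$ at $z=0$. For analytic functions $g,h$ on $\mathbb{D}$, $g\prec h$ ($g$ is subordinate to $h$) means that there is an analytic function $w:\mathbb{D}\to\mathbb{D}$ with $w(0)=0$ and $|w(z)|\le|z|$ such that $g(z)=h(w(z))$ for all $z\in\mathbb{D}$. *)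

(* Defs.v *)
From Stdlib Require Import Reals Lra.
From Coquelicot Require Import Coquelicot.
Open Scope R_scope.

Definition unit_disk (z : C) : Prop := Cmod z < 1.

(* Analyticity in the power-series sense. It is meant for open [U]: [f] is a
   total function, but then the radius can be taken so small that the values
   of [f] outside [U] play no role. *)
Definition analytic_on (U : C -> Prop) (f : C -> C) : Prop :=
  forall z0 : C, U z0 ->
  exists (r : R) (a : nat -> C), 0 < r /\
    forall z : C, Cmod (z - z0) < r ->
      is_pseries (K := C_AbsRing) (V := C_NormedModule) a (z - z0)%C (f z).

Definition Cexp (z : C) : C :=
  (exp (Re z) * cos (Im z), exp (Re z) * sin (Im z)).

(* Principal square root, i.e. the root with argument in (-PI/2, PI/2]; the
   formulas come from (Re w)^2 = (|z| + Re z)/2, (Im w)^2 = (|z| - Re z)/2 and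
   2 Re w Im w = Im z for w^2 = z. *)
Definition Csqrt (z : C) : C :=
  (sqrt ((Cmod z + Re z) / 2),
   (if Rlt_dec (Im z) 0 then -1 else 1) * sqrt ((Cmod z - Re z) / 2)).

Lemma Csqrt_sqr (z : C) : (Csqrt z ^ 2)%C = z.
Proof.
destruct z as [x y].
assert (Hm : Cmod (x, y) * Cmod (x, y) = x * x + y * y).
{ unfold Cmod; cbn [fst snd]; rewrite sqrt_sqrt; [ring | nra]. }
assert (H0 := Cmod_ge_0 (x, y)).
unfold Csqrt, Re, Im; cbn [fst snd].
set (m := Cmod (x, y)) in *.
assert (Hp : 0 <= (m + x) / 2) by nra.
assert (Hn : 0 <= (m - x) / 2) by nra.
assert (Hpn : sqrt ((m + x) / 2) * sqrt ((m - x) / 2) = Rabs y / 2).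
{ rewrite <- sqrt_mult by assumption.
  replace ((m + x) / 2 * ((m - x) / 2)) with (Rsqr (y / 2))
    by (unfold Rsqr; nra).
  rewrite sqrt_Rsqr_abs, Rabs_div by lra.
  now rewrite (Rabs_pos_eq 2) by lra. }
assert (Sp := sqrt_sqrt _ Hp).
assert (Sn := sqrt_sqrt _ Hn).
set (u := sqrt ((m + x) / 2)) in *.
set (v := sqrt ((m - x) / 2)) in *.
destruct (Rlt_dec y 0) as [Hy | Hy].
- rewrite Rabs_left in Hpn by assumption.
  unfold Cpow, Cmult, RtoC; cbn [fst snd]; f_equal; nra.
- rewrite Rabs_pos_eq in Hpn by lra.
  unfold Cpow, Cmult, RtoC; cbn [fst snd]; f_equal; nra.
Qed.

Lemma Csqrt_re_pos (z : C) : 0 < Re z \/ Im z <> 0 -> 0 < Re (Csqrt z).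
Proof.
destruct z as [x y]; unfold Csqrt, Re, Im; cbn [fst snd]; intros H.
assert (Hm : Cmod (x, y) * Cmod (x, y) = x * x + y * y).
{ unfold Cmod; cbn [fst snd]; rewrite sqrt_sqrt; [ring | nra]. }
assert (H0 := Cmod_ge_0 (x, y)).
apply sqrt_lt_R0.
destruct H as [H | H]; [lra |].
assert (0 < y * y) by nra.
nra.
Qed.

(* [subordinate g h] is g ≺ h; it is meant for [g], [h] analytic on the unit
   disk, and only their values there matter. *)
Definition subordinate (g h : C -> C) : Prop :=
  exists w : C -> C,
    analytic_on unit_disk w /\
    (forall z : C, unit_disk z -> unit_disk (w z)) /\
    w 0 = 0 /\
    (forall z : C, unit_disk z -> Cmod (w z) <= Cmod z) /\
    (forall z : C, unit_disk z -> g z = h (w z)).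

(* Main.v *)
Require Import Defs.
From Stdlib Require Import Reals Lra Lia Arith ClassicalEpsilon.
From Coquelicot Require Import Coquelicot.
Open Scope R_scope.

(** Write [p z] as the sum of [p_n z ^ n] on the disk. The function
    [p + gamma1 z p' + gamma2 z ^ 2 p''] has coefficients
    [h_n = (1 + gamma1 n + gamma2 n (n - 1)) p_n], and being subordinate to
    [z + sqrt (1 + z ^ 2)] it is bounded by [1 + sqrt 2] on the disk. By Bessel's
    inequality the sum of the [Cmod h_n ^ 2] is at most [(1 + sqrt 2) ^ 2 < 6].
    The hypotheses on the constants force [gamma1 >= 8] (lemma [gamma1_large]), so
    that [Cmod p_n <= Cmod h_n / (8 n)], and the inequality between arithmetic and
    geometric means shows that the [Cmod p_n] with [n >= 1] have sum at most [1/2]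
    (lemma [coefficient_sum_le]).

    Such a [p] lies well inside the domain of the principal logarithm, and it has
    a logarithm [w] whose coefficients can be bounded directly from the formal
    identity [p' = w' p]: their moduli sum to at most 1 (lemma
    [formal_log_bound]). As [w] vanishes at 0, this yields both convergence on the
    disk and [Cmod (w z) <= Cmod z], so [w] is the subordinating function (lemma
    [small_coefficients_log]).

    What remains is complex analysis of power series. Analyticity is a local
    condition, so the existence of a single expansion on the disk has to be
    proved. The route avoids integrals: Parseval's identity for polynomials
    sampled at roots of unity gives Bessel's inequality and the Cauchy estimates
    (lemmas [bessel] and [cauchy_estimate]); these, with compactness and
    recentring of power series ([expands_recenter]), show that an expansion valid
    on a disk of radius less than 1 extends to a larger one (lemma
    [expansion_extends]), hence to the whole unit disk ([taylor_on_disk]). *)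

(** * Finite sums and series of complex numbers *)

(** Finite sums with codomain [C] itself rather than the carrier of its monoid
    structure, so that [ring] applies to them. *)
Definition Csum (a : nat -> C) (n : nat) : C := sum_n (G := C_AbelianMonoid) a n.

Definition Cseries_to (a : nat -> C) (l : C) : Prop :=
  is_series (K := C_AbsRing) (V := C_NormedModule) a l.

Lemma Csum_O (a : nat -> C) : Csum a 0 = a 0%nat.
Proof. apply sum_O. Qed.

Lemma Csum_S (a : nat -> C) n : Csum a (S n) = (Csum a n + a (S n))%C.
Proof. exact (sum_Sn a n). Qed.

Lemma Rsum_S (a : nat -> R) n : sum_n a (S n) = sum_n a n + a (S n).
Proof. exact (sum_Sn a n). Qed.

Lemma Csum_scal (c : C) (a : nat -> C) n :
  Csum (fun k => c * a k)%C n = (c * Csum a n)%C.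
Proof. exact (sum_n_mult_l (K := C_Ring) c a n). Qed.

Lemma Csum_ext (a b : nat -> C) n :
  (forall k, (k <= n)%nat -> a k = b k) -> Csum a n = Csum b n.
Proof. exact (sum_n_ext_loc a b n). Qed.

Lemma Csum_const (c : C) n : Csum (fun _ => c) n = (INR (S n) * c)%C.
Proof.
induction n as [|n IH].
- rewrite Csum_O; simpl INR; ring.
- rewrite Csum_S, IH, (S_INR (S n)), RtoC_plus; ring.
Qed.

Lemma Csum_single (a : nat -> C) n m :
  (m <= n)%nat -> (forall k, (k <= n)%nat -> k <> m -> a k = RtoC 0) ->
  Csum a n = a m.
Proof.
induction n as [|n IH]; intros Hm H.
- rewrite Csum_O; f_equal; lia.
- rewrite Csum_S; destruct (Nat.eq_dec m (S n)) as [->|Hne].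
  + rewrite (Csum_ext _ (fun _ => RtoC 0)), Csum_const; [ring|].
    intros k Hk; apply H; lia.
  + rewrite (H (S n)) by lia; rewrite IH; [ring|lia|].
    intros k Hk Hkm; apply H; lia.
Qed.

Lemma Csum_switch (u : nat -> nat -> C) m n :
  Csum (fun i => Csum (u i) n) m = Csum (fun j => Csum (fun i => u i j) m) n.
Proof. exact (sum_n_switch u m n). Qed.

Lemma Csum_conj (a : nat -> C) n : Cconj (Csum a n) = Csum (fun k => Cconj (a k)) n.
Proof.
induction n as [|n IH]; [rewrite !Csum_O; reflexivity|].
rewrite !Csum_S, <- IH; unfold Cconj, Cplus; simpl; f_equal; ring.
Qed.

Lemma Csum_RtoC (a : nat -> R) n : Csum (fun k => RtoC (a k)) n = RtoC (sum_n a n).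
Proof.
induction n as [|n IH]; [rewrite Csum_O, sum_O; reflexivity|].
rewrite Csum_S, Rsum_S, IH, RtoC_plus; reflexivity.
Qed.

Lemma Cmod_Csum (a : nat -> C) n :
  Cmod (Csum a n) <= sum_n (fun k => Cmod (a k)) n.
Proof.
induction n as [|n IH].
- rewrite Csum_O, sum_O; apply Rle_refl.
- rewrite Csum_S, Rsum_S.
  eapply Rle_trans; [apply Cmod_triangle|]; lra.
Qed.

Lemma Rsum_le (a b : nat -> R) n :
  (forall k, (k <= n)%nat -> a k <= b k) -> sum_n a n <= sum_n b n.
Proof.
induction n as [|n IH]; intros H.
- rewrite !sum_O; apply H; lia.
- rewrite !Rsum_S; apply Rplus_le_compat; [apply IH; intros; apply H; lia|].
  apply H; lia.
Qed.

Lemma Rsum_scal c (a : nat -> R) n : sum_n (fun k => c * a k) n = c * sum_n a n.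
Proof. exact (sum_n_mult_l (K := R_Ring) c a n). Qed.

Lemma Rsum_plus (a b : nat -> R) n :
  sum_n (fun k => a k + b k) n = sum_n a n + sum_n b n.
Proof. exact (sum_n_plus (G := R_AbelianMonoid) a b n). Qed.

Lemma Rsum_ext (a b : nat -> R) n :
  (forall k, (k <= n)%nat -> a k = b k) -> sum_n a n = sum_n b n :> R.
Proof. exact (sum_n_ext_loc (G := R_AbelianMonoid) a b n). Qed.

Lemma Rsum_shift (a : nat -> R) n : sum_n a (S n) = a 0%nat + sum_n (fun k => a (S k)) n :> R.
Proof.
induction n as [|n IH].
- rewrite Rsum_S, !sum_O; reflexivity.
- rewrite Rsum_S, IH, (Rsum_S _ n); ring.
Qed.

Lemma Rsum_nonneg (a : nat -> R) n : (forall k, 0 <= a k) -> 0 <= sum_n a n.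
Proof.
intros H; induction n as [|n IH]; [rewrite sum_O; auto|].
rewrite Rsum_S; specialize (H (S n)); lra.
Qed.

Lemma Rsum_mono (a : nat -> R) n m :
  (forall k, 0 <= a k) -> (n <= m)%nat -> sum_n a n <= sum_n a m.
Proof.
intros H Hnm; induction Hnm as [|m _ IH]; [apply Rle_refl|].
rewrite Rsum_S; specialize (H (S m)); lra.
Qed.

Lemma Rsum_term_le (a : nat -> R) n m :
  (forall k, 0 <= a k) -> (m <= n)%nat -> a m <= sum_n a n.
Proof.
intros H Hm; apply Rle_trans with (sum_n a m); [|apply Rsum_mono; auto].
destruct m as [|m]; [rewrite sum_O; lra|].
rewrite Rsum_S; pose proof (Rsum_nonneg a m H); lra.
Qed.

Lemma Rsum_le_Series (a : nat -> R) n :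
  (forall k, 0 <= a k) -> ex_series a -> sum_n a n <= Series a.
Proof.
intros H Ha.
apply (is_lim_seq_incr_compare (sum_n a)).
- exact (Series_correct _ Ha).
- intros k; apply Rsum_mono; auto.
Qed.

Lemma Cseries_eps (a : nat -> C) (l : C) :
  Cseries_to a l <->
  forall eps, 0 < eps ->
    exists N, forall n, (N <= n)%nat -> Cmod (Csum a n - l) < eps.
Proof.
split.
- intros H eps He.
  assert (L : locally (l : C_NormedModule) (fun y => Cmod (y - l) < eps)).
  { apply (locally_le_locally_norm (V := C_NormedModule)).
    exists (mkposreal eps He); intros y Hy; exact Hy. }
  destruct (H _ L) as [N HN]; exists N; exact HN.
- intros H P HP.
  apply (locally_norm_le_locally (V := C_NormedModule)) in HP.
  destruct HP as [eps HP].
  destruct (H eps (cond_pos eps)) as [N HN].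
  exists N; intros n Hn; apply HP; exact (HN n Hn).
Qed.

Lemma Cseries_unique (a : nat -> C) (l m : C) :
  Cseries_to a l -> Cseries_to a m -> l = m.
Proof.
intros Hl Hm.
exact (filterlim_locally_unique (V := C_NormedModule) _ _ _ Hl Hm).
Qed.

Lemma Cseries_ext (a b : nat -> C) l :
  (forall n, a n = b n) -> Cseries_to a l -> Cseries_to b l.
Proof. apply is_series_ext. Qed.

Lemma Cseries_plus (a b : nat -> C) l m :
  Cseries_to a l -> Cseries_to b m ->
  Cseries_to (fun n => a n + b n)%C (l + m)%C.
Proof. exact (is_series_plus a b l m). Qed.

Lemma Cseries_minus (a b : nat -> C) l m :
  Cseries_to a l -> Cseries_to b m ->
  Cseries_to (fun n => a n - b n)%C (l - m)%C.
Proof. exact (is_series_minus a b l m). Qed.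

Lemma Cseries_scal (c : C) (a : nat -> C) l :
  Cseries_to a l -> Cseries_to (fun n => c * a n)%C (c * l)%C.
Proof. exact (is_series_scal c a l). Qed.

Lemma Cseries_zero : Cseries_to (fun _ => RtoC 0) (RtoC 0).
Proof.
apply Cseries_eps; intros eps He; exists 0%nat; intros n _.
replace (Csum (fun _ => RtoC 0) n) with (RtoC 0).
- replace (0 - 0)%C with (RtoC 0) by ring; rewrite Cmod_0; exact He.
- induction n as [|n IH]; [rewrite Csum_O|rewrite Csum_S, <- IH; ring]; auto.
Qed.

Lemma Cseries_shift (a : nat -> C) l :
  Cseries_to (fun n => a (S n)) l <-> Cseries_to a (l + a 0%nat)%C.
Proof.
split; intros H.
- apply (is_series_decr_1 (V := C_NormedModule)).
  cut (Cseries_to (fun n => a (S n)) (l + a 0%nat + - a 0%nat)%C); [auto|].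
  replace (l + a 0%nat + - a 0%nat)%C with l by ring; exact H.
- apply (is_series_incr_1 (V := C_NormedModule)); exact H.
Qed.

Lemma Cseries_abs (a : nat -> C) (g : nat -> R) :
  (forall n, Cmod (a n) <= g n) -> ex_series g -> exists l, Cseries_to a l.
Proof.
intros H Hg.
destruct (ex_series_le (V := C_CompleteNormedModule) a g) as [l Hl]; auto.
exists l; exact Hl.
Qed.

Lemma Cseries_bound (a : nat -> C) l M :
  Cseries_to a l ->
  (exists N, forall n, (N <= n)%nat -> Cmod (Csum a n) <= M) -> Cmod l <= M.
Proof.
intros Hl [N0 HM]; apply Rnot_lt_le; intros Hlt.
destruct (proj1 (Cseries_eps a l) Hl (Cmod l - M)) as [N HN]; [lra|].
specialize (HN (N + N0)%nat ltac:(lia)).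
specialize (HM (N + N0)%nat ltac:(lia)).
pose proof (Cmod_triangle (Csum a (N + N0)) (l - Csum a (N + N0))) as T.
replace (Csum a (N + N0) + (l - Csum a (N + N0)))%C with l in T by ring.
rewrite <- Cmod_opp in HN.
replace (- (Csum a (N + N0) - l))%C with (l - Csum a (N + N0))%C in HN by ring.
lra.
Qed.

Lemma Cseries_bound_Series (a : nat -> C) (g : nat -> R) l :
  (forall n, Cmod (a n) <= g n) -> ex_series g -> Cseries_to a l ->
  Cmod l <= Series g.
Proof.
intros H Hg Hl; apply (Cseries_bound a); auto; exists 0%nat; intros n _.
eapply Rle_trans; [apply Cmod_Csum|].
eapply Rle_trans; [apply Rsum_le; intros; apply H|].
apply Rsum_le_Series; auto.
intros k; eapply Rle_trans; [apply Cmod_ge_0|apply H].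
Qed.

Lemma Cseries_terms_bounded (a : nat -> C) l :
  Cseries_to a l -> exists M, forall n, Cmod (a n) <= M.
Proof.
intros H.
destruct (filterlim_bounded (V := C_NormedModule) (sum_n a)) as [M HM].
{ exists l; exact H. }
exists (2 * M); intros n.
assert (HM' : forall k, Cmod (Csum a k) <= M) by (intros k; exact (HM k)).
destruct n as [|n].
- pose proof (HM' 0%nat) as H0; rewrite Csum_O in H0.
  pose proof (Cmod_ge_0 (a 0%nat)); lra.
- pose proof (HM' (S n)) as H1; pose proof (HM' n) as H2.
  pose proof (Cmod_triangle (Csum a (S n)) (- Csum a n)) as T.
  rewrite Cmod_opp in T.
  replace (Csum a (S n) + - Csum a n)%C with (a (S n)) in T
    by (rewrite Csum_S; ring).
  lra.
Qed.

Lemma Cseries_tail (a : nat -> C) (g : nat -> R) l N :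
  (forall n, Cmod (a n) <= g n) -> ex_series g -> Cseries_to a l ->
  Cmod (Csum a N - l) <= Series g - sum_n g N.
Proof.
intros H Hg Hl.
assert (g0 : forall n, 0 <= g n)
  by (intros n; eapply Rle_trans; [apply Cmod_ge_0|apply H]).
apply le_epsilon; intros eps He.
destruct (proj1 (Cseries_eps a l) Hl eps He) as [K HK].
specialize (HK (K + N)%nat ltac:(lia)).
assert (D : Cmod (Csum a N - Csum a (K + N)) <= sum_n g (K + N) - sum_n g N).
{ clear HK; induction K as [|K IH]; simpl.
  - replace (Csum a N - Csum a N)%C with (RtoC 0) by ring; rewrite Cmod_0; lra.
  - rewrite Csum_S, Rsum_S.
    pose proof (Cmod_triangle (Csum a N - Csum a (K + N)) (- a (S (K + N)))) as T.
    replace (Csum a N - (Csum a (K + N) + a (S (K + N))))%C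
      with (Csum a N - Csum a (K + N) + - a (S (K + N)))%C by ring.
    rewrite Cmod_opp in T; specialize (H (S (K + N))); lra. }
pose proof (Rsum_le_Series g (K + N) g0 Hg).
pose proof (Cmod_triangle (Csum a N - Csum a (K + N)) (Csum a (K + N) - l)) as T.
replace (Csum a N - Csum a (K + N) + (Csum a (K + N) - l))%C
  with (Csum a N - l)%C in T by ring.
lra.
Qed.

(** Interchange of summation for a triangular array. The partial sum
    [Csum b M] of the column sums is the sum of the series of rows truncated at
    column [M]; it differs from [l] only by the rows of index above [M], where
    each difference is at most twice the dominating term. *)
Lemma Cseries_columns (T : nat -> nat -> C) (g : nat -> R) (b : nat -> C) l :
  (forall n m, (n < m)%nat -> T n m = RtoC 0) ->
  (forall n M, Cmod (Csum (T n) M) <= g n) -> ex_series g ->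
  (forall m, Cseries_to (fun n => T n m) (b m)) ->
  Cseries_to (fun n => Csum (T n) n) l -> Cseries_to b l.
Proof.
intros HT Hg Eg Hb Hl.
assert (g0 : forall n, 0 <= g n).
{ intros n; eapply Rle_trans; [apply Cmod_ge_0|apply (Hg n 0%nat)]. }
assert (HB : forall M, Cseries_to (fun n => Csum (T n) M) (Csum b M)).
{ induction M as [|M IH].
  - rewrite Csum_O; apply Cseries_ext with (2 := Hb 0%nat).
    intros n; rewrite Csum_O; reflexivity.
  - rewrite Csum_S; apply Cseries_ext with (2 := Cseries_plus _ _ _ _ IH (Hb (S M))).
    intros n; rewrite Csum_S; reflexivity. }
assert (Hstab : forall n M, (n <= M)%nat -> Csum (T n) M = Csum (T n) n).
{ intros n M H; induction H as [|M H IH]; [reflexivity|].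
  rewrite Csum_S, IH, HT by lia; ring. }
assert (Hd : forall M, Cmod (Csum b M - l) <= 2 * (Series g - sum_n g M)).
{ intros M.
  apply (Cseries_bound _ _ _ (Cseries_minus _ _ _ _ (HB M) Hl)).
  exists M; intros n Hn.
  apply Rle_trans with (2 * (sum_n g n - sum_n g M)).
  2:{ pose proof (Rsum_le_Series g n g0 Eg); lra. }
  induction Hn as [|n Hn IH].
  - assert (Z : forall k, (k <= M)%nat ->
        Csum (fun n => Csum (T n) M - Csum (T n) n)%C k = RtoC 0).
    { induction k as [|k IHk]; intros Hk.
      - rewrite Csum_O, Hstab by lia; ring.
      - rewrite Csum_S, IHk, Hstab by lia; ring. }
    rewrite Z, Cmod_0 by lia; lra.
  - rewrite Csum_S, Rsum_S.
    pose proof (Cmod_triangle (Csum (fun n => Csum (T n) M - Csum (T n) n)%C n)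
       (Csum (T (S n)) M - Csum (T (S n)) (S n))) as T1.
    pose proof (Cmod_triangle (Csum (T (S n)) M) (- Csum (T (S n)) (S n))) as T2.
    rewrite Cmod_opp in T2.
    change (Csum (T (S n)) M + - Csum (T (S n)) (S n))%C
      with (Csum (T (S n)) M - Csum (T (S n)) (S n))%C in T2.
    pose proof (Hg (S n) M); pose proof (Hg (S n) (S n)); lra. }
apply Cseries_eps; intros eps He.
assert (Lg : is_lim_seq (sum_n g) (Series g)) by exact (Series_correct _ Eg).
apply is_lim_seq_spec in Lg.
destruct (Lg (mkposreal (eps / 2) ltac:(lra))) as [N HN]; simpl in HN.
exists N; intros n Hn; eapply Rle_lt_trans; [apply Hd|].
specialize (HN n Hn); apply Rabs_def2 in HN; lra.
Qed.

(** A total sum, computed on real and imaginary parts, so that the sum of a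
    power series can be written as a function of the point. *)
Definition Cseries (a : nat -> C) : C :=
  (Series (fun n => Re (a n)), Series (fun n => Im (a n))).

Lemma Csum_Re a n : Re (Csum a n) = sum_n (fun k => Re (a k)) n.
Proof.
induction n as [|n IH]; [rewrite Csum_O, sum_O|rewrite Csum_S, Rsum_S, <- IH];
  reflexivity.
Qed.

Lemma Csum_Im a n : Im (Csum a n) = sum_n (fun k => Im (a k)) n.
Proof.
induction n as [|n IH]; [rewrite Csum_O, sum_O|rewrite Csum_S, Rsum_S, <- IH];
  reflexivity.
Qed.

Lemma im_le_Cmod (c : C) : Rabs (Im c) <= Cmod c.
Proof.
eapply Rle_trans; [|apply Rmax_Cmod]; apply Rmax_r.
Qed.

Lemma Cseries_value (a : nat -> C) l : Cseries_to a l -> Cseries a = l.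
Proof.
intros H; pose proof (proj1 (Cseries_eps a l) H) as He.
unfold Cseries; rewrite (surjective_pairing l); f_equal; apply is_series_unique.
- change (is_lim_seq (sum_n (fun n => Re (a n))) (Re l)).
  apply is_lim_seq_spec; intros eps.
  destruct (He eps (cond_pos eps)) as [N HN]; exists N; intros n Hn.
  rewrite <- Csum_Re; eapply Rle_lt_trans; [|apply (HN n Hn)].
  change (Re (Csum a n) - Re l) with (Re (Csum a n - l)); apply re_le_Cmod.
- change (is_lim_seq (sum_n (fun n => Im (a n))) (Im l)).
  apply is_lim_seq_spec; intros eps.
  destruct (He eps (cond_pos eps)) as [N HN]; exists N; intros n Hn.
  rewrite <- Csum_Im; eapply Rle_lt_trans; [|apply (HN n Hn)].
  change (Im (Csum a n) - Im l) with (Im (Csum a n - l)); apply im_le_Cmod.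
Qed.

Lemma Cseries_correct (a : nat -> C) (g : nat -> R) :
  (forall n, Cmod (a n) <= g n) -> ex_series g -> Cseries_to a (Cseries a).
Proof.
intros H Hg; destruct (Cseries_abs a g H Hg) as [l Hl].
rewrite (Cseries_value a l Hl); exact Hl.
Qed.

(** * Power series and their recentring *)

(** Pascal's triangle with zeros above the diagonal, which the double sums
    below rely on. *)
Fixpoint binom (n m : nat) : nat :=
  match n, m with
  | _, O => 1
  | O, S _ => 0
  | S n', S m' => binom n' m' + binom n' m
  end.

Lemma binom_0 n : binom n 0 = 1%nat.
Proof. destruct n; reflexivity. Qed.

Lemma binom_above n m : (n < m)%nat -> binom n m = 0%nat.
Proof.
revert m; induction n as [|n IH]; intros [|m] H; try lia; [reflexivity|].
simpl; rewrite !IH by lia; reflexivity.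
Qed.

Lemma binom_1 n : binom n 1 = n.
Proof. induction n as [|n IH]; [reflexivity|]. simpl; rewrite IH, binom_0; lia. Qed.

Definition binomial_term (x y : C) (n m : nat) : C :=
  (INR (binom n m) * x ^ (n - m) * y ^ m)%C.

Lemma binomial_term_above x y n m : (n < m)%nat -> binomial_term x y n m = RtoC 0.
Proof.
intros H; unfold binomial_term; rewrite binom_above by lia; simpl INR; ring.
Qed.

Lemma binomial_term_0 x y n : binomial_term x y n 0 = (x ^ n)%C.
Proof.
unfold binomial_term; rewrite binom_0, Nat.sub_0_r; simpl INR; simpl (y ^ 0)%C; ring.
Qed.

Lemma binomial_term_S x y n m :
  binomial_term x y (S n) (S m) =
  (x * binomial_term x y n (S m) + y * binomial_term x y n m)%C.
Proof.
unfold binomial_term.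
change (binom (S n) (S m)) with (binom n m + binom n (S m))%nat.
rewrite plus_INR, RtoC_plus, Cpow_S.
change (S n - S m)%nat with (n - m)%nat.
destruct (Nat.lt_ge_cases m n) as [H|H].
- replace (n - m)%nat with (S (n - S m)) by lia.
  rewrite Cpow_S; ring.
- rewrite (binom_above n (S m)) by lia; simpl INR; ring.
Qed.

Lemma Csum_binomial_S x y n M :
  Csum (binomial_term x y (S n)) (S M) =
  (x * Csum (binomial_term x y n) (S M) + y * Csum (binomial_term x y n) M)%C.
Proof.
induction M as [|M IH].
- rewrite !Csum_S, !Csum_O, binomial_term_S, !binomial_term_0, Cpow_S; ring.
- rewrite Csum_S, IH, binomial_term_S, !(Csum_S _ (S M)), (Csum_S _ M); ring.
Qed.

(** The binomial theorem; any number of the vanishing terms above the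
    diagonal may be included. *)
Lemma Csum_binomial x y n M :
  (n <= M)%nat -> Csum (binomial_term x y n) M = ((x + y) ^ n)%C.
Proof.
revert M; induction n as [|n IH]; intros M HM.
- clear HM; induction M as [|M IHM].
  + rewrite Csum_O, binomial_term_0; reflexivity.
  + rewrite Csum_S, IHM, binomial_term_above by lia; ring.
- destruct M as [|M]; [lia|].
  rewrite Csum_binomial_S, !IH, Cpow_S by lia; ring.
Qed.

Definition Rbinomial_term (x y : R) (n m : nat) : R :=
  INR (binom n m) * x ^ (n - m) * y ^ m.

Lemma Cmod_binomial_term x y n m :
  Cmod (binomial_term x y n m) = Rbinomial_term (Cmod x) (Cmod y) n m.
Proof.
unfold binomial_term, Rbinomial_term.
rewrite !Cmod_mult, !Cmod_pow, Cmod_R, Rabs_pos_eq; [reflexivity|apply pos_INR].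
Qed.

Lemma Rbinomial_term_nonneg x y n m :
  0 <= x -> 0 <= y -> 0 <= Rbinomial_term x y n m.
Proof.
intros Hx Hy; unfold Rbinomial_term.
apply Rmult_le_pos; [apply Rmult_le_pos|]; auto using pos_INR, pow_le.
Qed.

Lemma Rsum_binomial x y n : sum_n (Rbinomial_term x y n) n = (x + y) ^ n.
Proof.
apply RtoC_inj; rewrite RtoC_pow, RtoC_plus, <- (Csum_binomial x y n n) by lia.
assert (H : forall M, RtoC (sum_n (Rbinomial_term x y n) M)
                      = Csum (binomial_term x y n) M); [|apply H].
assert (E : forall m, RtoC (Rbinomial_term x y n m) = binomial_term x y n m).
{ intros m; unfold Rbinomial_term, binomial_term.
  rewrite !RtoC_mult, !RtoC_pow; reflexivity. }
induction M as [|M IH].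
- rewrite sum_O, Csum_O; apply E.
- rewrite Rsum_S, Csum_S, RtoC_plus, IH, E; reflexivity.
Qed.

Lemma Rsum_binomial_le x y n M :
  0 <= x -> 0 <= y -> sum_n (Rbinomial_term x y n) M <= (x + y) ^ n.
Proof.
intros Hx Hy.
assert (P : forall m, 0 <= Rbinomial_term x y n m)
  by (intros; apply Rbinomial_term_nonneg; auto).
rewrite <- Rsum_binomial.
destruct (Nat.le_ge_cases M n) as [H|H]; [apply Rsum_mono; auto|].
apply Req_le; induction H as [|M H IH]; [reflexivity|].
rewrite Rsum_S, IH; unfold Rbinomial_term at 2; rewrite binom_above by lia.
simpl INR; ring.
Qed.

Definition expands (f : C -> C) (z0 : C) (r : R) (a : nat -> C) : Prop :=
  forall z, Cmod (z - z0) < r -> Cseries_to (fun n => a n * (z - z0) ^ n)%C (f z).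

Lemma pow_n_Cpow (z : C) n : pow_n (K := C_AbsRing) z n = (z ^ n)%C.
Proof. induction n as [|n IH]; [reflexivity|]; simpl; rewrite IH; reflexivity. Qed.

Lemma is_pseries_Cseries (a : nat -> C) (z l : C) :
  is_pseries (K := C_AbsRing) (V := C_NormedModule) a z l <->
  Cseries_to (fun n => a n * z ^ n)%C l.
Proof.
assert (E : forall n, scal (V := C_NormedModule) (pow_n (K := C_AbsRing) z n) (a n)
                      = (a n * z ^ n)%C).
{ intros n; rewrite pow_n_Cpow; apply Cmult_comm. }
split; intros H.
- exact (is_series_ext (V := C_NormedModule) _ _ _ E H).
- apply (is_series_ext (V := C_NormedModule) _ _ _ (fun n => eq_sym (E n)) H).
Qed.

Lemma analytic_on_expands U f :
  analytic_on U f <->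
  forall z0, U z0 -> exists r a, 0 < r /\ expands f z0 r a.
Proof.
split; intros H z0 Hz0; destruct (H z0 Hz0) as (r & a & Hr & Ha);
  exists r, a; split; auto; intros z Hz; apply is_pseries_Cseries; auto.
Qed.

Lemma ex_series_of_bounded (c : nat -> R) M r s :
  0 <= r < s -> (forall n, 0 <= c n) -> (forall n, c n * s ^ n <= M) ->
  ex_series (fun n => c n * r ^ n).
Proof.
intros Hr Hc HM.
assert (Hq : Rabs (r / s) < 1).
{ rewrite Rabs_pos_eq; [apply Rlt_div_l; lra|].
  apply Rmult_le_pos; [lra|left; apply Rinv_0_lt_compat; lra]. }
apply (ex_series_le (V := R_CompleteNormedModule) _ (fun n => M * (r / s) ^ n)).
- intros n; change (Rabs (c n * r ^ n) <= M * (r / s) ^ n).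
  rewrite Rabs_pos_eq; [|apply Rmult_le_pos; auto; apply pow_le; lra].
  replace (c n * r ^ n) with (c n * s ^ n * (r / s) ^ n).
  + apply Rmult_le_compat_r; auto; apply pow_le.
    apply Rmult_le_pos; [lra|left; apply Rinv_0_lt_compat; lra].
  + rewrite Rmult_assoc, <- Rpow_mult_distr.
    replace (s * (r / s)) with r by (field; lra); reflexivity.
- apply (ex_series_scal (V := R_NormedModule) M (fun n => (r / s) ^ n)).
  apply ex_series_geom; auto.
Qed.

Lemma expands_at f z0 r a h :
  expands f z0 r a -> Cmod h < r ->
  Cseries_to (fun n => a n * h ^ n)%C (f (z0 + h)%C).
Proof.
intros H Hh.
replace h with (z0 + h - z0)%C in Hh by ring.
specialize (H _ Hh).
replace (z0 + h - z0)%C with h in H by ring; exact H.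
Qed.

(** Abel's argument: the terms are bounded at a point of intermediate modulus,
    hence decay geometrically on the smaller circle. *)
Lemma expands_abs f z0 r a s :
  expands f z0 r a -> 0 <= s < r -> ex_series (fun n => Cmod (a n) * s ^ n).
Proof.
intros H Hs; set (t := (s + r) / 2).
destruct (Cseries_terms_bounded (fun n => a n * t ^ n)%C (f (z0 + t)%C)) as [M HM].
{ apply (expands_at f z0 r); auto.
  rewrite Cmod_R, Rabs_pos_eq; unfold t; lra. }
apply (ex_series_of_bounded _ M s t).
- unfold t; lra.
- intros; apply Cmod_ge_0.
- intros n; specialize (HM n).
  rewrite Cmod_mult, Cmod_pow, Cmod_R, Rabs_pos_eq in HM; [exact HM|unfold t; lra].
Qed.

Lemma expands_of_abs (a : nat -> C) r :
  (forall s, 0 <= s < r -> ex_series (fun n => Cmod (a n) * s ^ n)) ->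
  expands (fun z => Cseries (fun n => a n * z ^ n)%C) 0 r a.
Proof.
intros H z Hz.
replace (z - 0)%C with z in * by ring.
apply (Cseries_correct _ (fun n => Cmod (a n) * Cmod z ^ n)).
- intros n; rewrite Cmod_mult, Cmod_pow; apply Rle_refl.
- apply H; split; [apply Cmod_ge_0|auto].
Qed.

Lemma expands_radius f z0 r r' a : r' <= r -> expands f z0 r a -> expands f z0 r' a.
Proof. intros Hr H z Hz; apply H; lra. Qed.

Lemma expands_ext f g z0 r a b :
  (forall z, Cmod (z - z0) < r -> f z = g z) -> (forall n, a n = b n) ->
  expands f z0 r a -> expands g z0 r b.
Proof.
intros E Eab H z Hz; rewrite <- E by auto.
apply Cseries_ext with (2 := H z Hz); intros n; rewrite Eab; reflexivity.
Qed.

Lemma expands_scal c f z0 r a :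
  expands f z0 r a -> expands (fun z => c * f z)%C z0 r (fun n => c * a n)%C.
Proof.
intros H z Hz; apply Cseries_ext with (2 := Cseries_scal c _ _ (H z Hz)).
intros n; ring.
Qed.

Lemma expands_plus f g z0 r a b :
  expands f z0 r a -> expands g z0 r b ->
  expands (fun z => f z + g z)%C z0 r (fun n => a n + b n)%C.
Proof.
intros Ha Hb z Hz; apply Cseries_ext with (2 := Cseries_plus _ _ _ _ (Ha z Hz) (Hb z Hz)).
intros n; ring.
Qed.

Lemma expands_value f z0 r a : 0 < r -> expands f z0 r a -> f z0 = a 0%nat.
Proof.
intros Hr H; specialize (H z0).
replace (z0 - z0)%C with (RtoC 0) in H by ring.
rewrite Cmod_0 in H; specialize (H Hr).
apply (Cseries_unique _ _ _ H).
replace (a 0%nat) with (0 + a 0%nat * 0 ^ 0)%C by (simpl; ring).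
apply (Cseries_shift (fun n => a n * 0 ^ n)%C).
apply Cseries_ext with (2 := Cseries_zero).
intros n; rewrite Cpow_S; ring.
Qed.

(** The [m]-th coefficient of the expansion around [d] of the sum of the series
    [a] around 0, that is, its [m]-th derivative at [d] over [m!]. *)
Definition taylor (a : nat -> C) (m : nat) (d : C) : C :=
  Cseries (fun k => (INR (binom (k + m) m) * a (k + m)%nat) * d ^ k)%C.

(** The binomial coefficient is absorbed by a small increase of the radius:
    [binom (k + m) m * s ^ k * e ^ m] is one term of [(s + e) ^ (k + m)]. *)
Lemma taylor_abs (a : nat -> C) r m s :
  (forall s, 0 <= s < r -> ex_series (fun n => Cmod (a n) * s ^ n)) ->
  0 <= s < r ->
  ex_series (fun k => Cmod (INR (binom (k + m) m) * a (k + m)%nat)%C * s ^ k).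
Proof.
intros H Hs; set (e := (r - s) / 2).
assert (He : 0 < e) by (unfold e; lra).
assert (E : ex_series (fun k => / e ^ m * (Cmod (a (k + m)%nat) * (s + e) ^ (k + m)))).
{ apply (ex_series_scal (V := R_NormedModule) (/ e ^ m)
     (fun k => Cmod (a (k + m)%nat) * (s + e) ^ (k + m))).
  destruct (H (s + e)) as [l Hl]; [unfold e in *; lra|].
  apply (ex_series_ext (V := R_NormedModule)
           (fun k => Cmod (a (m + k)%nat) * (s + e) ^ (m + k))).
  { intros k; rewrite Nat.add_comm; reflexivity. }
  apply (ex_series_incr_n (V := R_NormedModule)
    (fun n => Cmod (a n) * (s + e) ^ n) m).
  exists l; exact Hl. }
apply (ex_series_le (V := R_CompleteNormedModule) _ _) with (2 := E).
intros k.
change (norm ?x) with (Rabs x).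
rewrite Rabs_pos_eq.
2:{ apply Rmult_le_pos; [apply Cmod_ge_0|apply pow_le; lra]. }
rewrite Cmod_mult, Cmod_R, (Rabs_pos_eq (INR _)) by apply pos_INR.
assert (B : INR (binom (k + m) m) * s ^ k * e ^ m <= (s + e) ^ (k + m)).
{ rewrite <- (Rsum_binomial s e (k + m)).
  replace (INR (binom (k + m) m) * s ^ k * e ^ m)
    with (Rbinomial_term s e (k + m) m).
  - apply (Rsum_term_le (Rbinomial_term s e (k + m))); [|lia].
    intros; apply Rbinomial_term_nonneg; lra.
  - unfold Rbinomial_term; rewrite Nat.add_sub; reflexivity. }
assert (P : 0 < e ^ m) by (apply pow_lt; auto).
apply Rmult_le_reg_l with (e ^ m); auto.
replace (e ^ m * (/ e ^ m * (Cmod (a (k + m)%nat) * (s + e) ^ (k + m))))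
  with (Cmod (a (k + m)%nat) * (s + e) ^ (k + m)) by (field; lra).
replace (e ^ m * (INR (binom (k + m) m) * Cmod (a (k + m)%nat) * s ^ k))
  with (Cmod (a (k + m)%nat) * (INR (binom (k + m) m) * s ^ k * e ^ m)) by ring.
apply Rmult_le_compat_l; auto; apply Cmod_ge_0.
Qed.

Lemma taylor_expands (a : nat -> C) r m :
  (forall s, 0 <= s < r -> ex_series (fun n => Cmod (a n) * s ^ n)) ->
  expands (taylor a m) 0 r (fun k => INR (binom (k + m) m) * a (k + m)%nat)%C.
Proof.
intros H; apply (expands_of_abs (fun k => INR (binom (k + m) m) * a (k + m)%nat)%C).
intros s Hs; apply (taylor_abs _ r); auto.
Qed.

Lemma Cseries_shift_n (a : nat -> C) m l :
  (forall n, (n < m)%nat -> a n = RtoC 0) ->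
  Cseries_to (fun k => a (k + m)%nat) l -> Cseries_to a l.
Proof.
revert a l; induction m as [|m IH]; intros a l Z H.
- apply Cseries_ext with (2 := H); intros n; rewrite Nat.add_0_r; reflexivity.
- replace l with (l + a 0%nat)%C by (rewrite Z by lia; ring).
  apply Cseries_shift, IH; [intros n Hn; apply Z; lia|].
  apply Cseries_ext with (2 := H); intros n; f_equal; lia.
Qed.

(** Expanding [(d + h) ^ n] by the binomial theorem turns the series at [z0]
    into a triangular array dominated by [Cmod (a n) * (Cmod d + Cmod h) ^ n];
    its columns are the Taylor coefficients at [z1]. *)
Lemma expands_recenter f z0 r a z1 :
  expands f z0 r a -> Cmod (z1 - z0) < r ->
  expands f z1 (r - Cmod (z1 - z0)) (fun m => taylor a m (z1 - z0)).
Proof.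
intros Hf Hz1 z Hz.
set (d := (z1 - z0)%C) in *; set (h := (z - z1)%C) in *.
pose proof (Cmod_ge_0 d) as Hd0; pose proof (Cmod_ge_0 h) as Hh0.
assert (Habs : forall s, 0 <= s < r -> ex_series (fun n => Cmod (a n) * s ^ n))
  by (intros s Hs; apply (expands_abs f z0 r); auto).
apply (Cseries_columns (fun n m => a n * binomial_term d h n m)%C
         (fun n => Cmod (a n) * (Cmod d + Cmod h) ^ n)).
- intros n m H; rewrite binomial_term_above by lia; ring.
- intros n M; rewrite Csum_scal, Cmod_mult.
  apply Rmult_le_compat_l; [apply Cmod_ge_0|].
  eapply Rle_trans; [apply Cmod_Csum|].
  eapply Rle_trans; [|apply (Rsum_binomial_le _ _ n M Hd0 Hh0)].
  apply Rsum_le; intros; rewrite Cmod_binomial_term; apply Rle_refl.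
- apply Habs; lra.
- intros m; apply (Cseries_shift_n _ m).
  { intros n H; rewrite binomial_term_above by lia; ring. }
  assert (T := taylor_expands a r m Habs d).
  replace (d - 0)%C with d in T by ring; specialize (T Hz1).
  rewrite (Cmult_comm (taylor a m d)).
  apply Cseries_ext with (2 := Cseries_scal (h ^ m)%C _ _ T).
  intros k; unfold binomial_term; rewrite Nat.add_sub; ring.
- assert (Hdh : Cmod (z - z0) < r).
  { replace (z - z0)%C with (d + h)%C by (unfold d, h; ring).
    pose proof (Cmod_triangle d h); lra. }
  apply Cseries_ext with (2 := Hf z Hdh).
  intros n; rewrite Csum_scal, Csum_binomial by lia.
  replace (z - z0)%C with (d + h)%C by (unfold d, h; ring); reflexivity.
Qed.

(** * Parseval identity on roots of unity *)

Definition cis (t : R) : C := (cos t, sin t).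

Lemma cis_plus s t : cis (s + t) = (cis s * cis t)%C.
Proof.
unfold cis, Cmult; simpl; rewrite cos_plus, sin_plus; f_equal; ring.
Qed.

Lemma cis_0 : cis 0 = RtoC 1.
Proof. unfold cis; rewrite cos_0, sin_0; reflexivity. Qed.

Lemma cis_pow t n : (cis t ^ n)%C = cis (INR n * t).
Proof.
induction n as [|n IH].
- simpl; rewrite Rmult_0_l, cis_0; reflexivity.
- rewrite Cpow_S, IH, <- cis_plus, S_INR; f_equal; ring.
Qed.

Lemma Cmod_cis t : Cmod (cis t) = 1.
Proof.
unfold Cmod, cis; simpl fst; simpl snd.
pose proof (sin2_cos2 t) as H; unfold Rsqr in H.
replace (cos t ^ 2 + sin t ^ 2) with 1 by (rewrite <- H; ring).
apply sqrt_1.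
Qed.

Lemma cis_conj t : Cconj (cis t) = cis (- t).
Proof. unfold Cconj, cis; simpl; rewrite cos_neg, sin_neg; reflexivity. Qed.

Lemma cis_2kPI (n : nat) : cis (INR n * (2 * PI)) = RtoC 1.
Proof.
rewrite <- cis_pow.
replace (cis (2 * PI)) with (RtoC 1); [apply Cpow_1_l|].
unfold cis; rewrite cos_2PI, sin_2PI; reflexivity.
Qed.

Lemma cis_neq_1 x : 0 < x < 2 * PI -> cis x <> RtoC 1.
Proof.
intros Hx H; apply (f_equal fst) in H; unfold cis in H; simpl in H.
assert (S : 0 < sin (x / 2)) by (apply sin_gt_0; lra).
replace x with (2 * (x / 2)) in H by field.
rewrite cos_2a_sin in H; nra.
Qed.

Lemma geometric_sum (u : C) n :
  ((u - 1) * Csum (fun k => u ^ k) n)%C = (u ^ S n - 1)%C.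
Proof.
induction n as [|n IH].
- rewrite Csum_O; simpl; ring.
- rewrite Csum_S, Cmult_plus_distr_l, IH, (Cpow_S _ (S n)); ring.
Qed.

(** Orthogonality of the characters of the cyclic group of order [N + 1]: for
    [n <> m] the sum is geometric, and its ratio is an [N + 1]-th root of unity
    different from 1. *)
Lemma roots_orthogonal N n m :
  (n <= N)%nat -> (m <= N)%nat ->
  let t := 2 * PI / INR (S N) in
  Csum (fun k => (cis (INR k * t)) ^ n * Cconj (cis (INR k * t) ^ m))%C N
  = if Nat.eq_dec n m then RtoC (INR (S N)) else RtoC 0.
Proof.
intros Hn Hm t.
assert (HN : 0 < INR (S N)) by (apply lt_0_INR; lia).
set (x := (INR n - INR m) * t).
assert (E : forall k,
  ((cis (INR k * t)) ^ n * Cconj (cis (INR k * t) ^ m))%C = (cis x ^ k)%C).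
{ intros k; rewrite !cis_pow, cis_conj, <- cis_plus; f_equal; unfold x; ring. }
rewrite (Csum_ext _ (fun k => cis x ^ k)%C) by (intros; apply E).
destruct (Nat.eq_dec n m) as [->|Hne].
- replace x with 0 by (unfold x; ring).
  rewrite cis_0, (Csum_ext _ (fun _ => RtoC 1)) by (intros; apply Cpow_1_l).
  rewrite Csum_const; ring.
- assert (U : (cis x ^ S N)%C = RtoC 1).
  { rewrite cis_pow.
    replace (INR (S N) * x) with (INR n * (2 * PI) + - (INR m * (2 * PI)))
      by (unfold x, t; field; lra).
    rewrite cis_plus, <- cis_conj, !cis_2kPI.
    unfold Cconj, RtoC, Cmult; simpl; f_equal; ring. }
  assert (V : cis x <> RtoC 1).
  { assert (G : forall p q : nat, (p < q <= N)%nat -> 0 < (INR q - INR p) * t < 2 * PI).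
    { intros p q [H1 H2].
      apply lt_INR in H1; apply le_INR in H2; pose proof (pos_INR p).
      pose proof (S_INR N); unfold t; pose proof PI_RGT_0; split.
      - apply Rmult_lt_0_compat; [lra|]; apply Rdiv_lt_0_compat; lra.
      - replace ((INR q - INR p) * (2 * PI / INR (S N)))
          with ((INR q - INR p) / INR (S N) * (2 * PI)) by (field; lra).
        rewrite <- (Rmult_1_l (2 * PI)) at 2.
        apply Rmult_lt_compat_r; [lra|]; apply Rlt_div_l; lra. }
    destruct (Nat.lt_gt_cases n m) as [Hc _]; destruct (Hc Hne) as [H|H].
    - intros W; apply (cis_neq_1 (- x)).
      + replace (- x) with ((INR m - INR n) * t) by (unfold x; ring); apply G; lia.
      + rewrite <- cis_conj, W; unfold Cconj, RtoC; simpl; f_equal; ring.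
    - apply cis_neq_1, G; lia. }
  pose proof (geometric_sum (cis x) N) as S; rewrite U in S.
  replace (RtoC 1 - RtoC 1)%C with (RtoC 0) in S by ring.
  destruct (Ceq_dec (Csum (fun k => cis x ^ k)%C N) 0) as [Z|Z]; [exact Z|].
  exfalso; apply (Cmult_neq_0 (cis x - 1)%C _) with (3 := S); auto.
  intros W; apply V; replace (cis x) with (cis x - 1 + 1)%C by ring; rewrite W; ring.
Qed.

(** A polynomial of degree at most [N] is sampled at the [N + 1]-th roots of
    unity, which makes Parseval's identity a finite computation. *)
Lemma parseval_polynomial (A : nat -> C) N :
  sum_n (fun k => Cmod (Csum (fun n => A n * cis (INR k * (2 * PI / INR (S N))) ^ n)%C N) ^ 2) N
  = INR (S N) * sum_n (fun n => Cmod (A n) ^ 2) N.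
Proof.
set (t := 2 * PI / INR (S N)).
apply RtoC_inj; rewrite <- Csum_RtoC, RtoC_mult, <- Csum_RtoC, <- Csum_scal.
set (c := fun k => cis (INR k * t)).
transitivity (Csum (fun k => Csum (fun n => Csum (fun m =>
   (A n * Cconj (A m)) * (c k ^ n * Cconj (c k ^ m)))%C N) N) N).
{ apply Csum_ext; intros k _.
  rewrite Cmod2_conj, Csum_conj.
  rewrite (Cmult_comm (Csum _ N)), <- Csum_scal.
  apply Csum_ext; intros n _.
  rewrite Cmult_comm, <- Csum_scal; apply Csum_ext; intros m _.
  rewrite Cmult_conj; unfold c; ring. }
rewrite Csum_switch; apply Csum_ext; intros n Hn.
rewrite Csum_switch.
rewrite (Csum_single _ N n Hn).
- pose proof (roots_orthogonal N n n Hn Hn) as O; cbv zeta in O; fold t in O.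
  rewrite Csum_scal; unfold c; rewrite O.
  destruct (Nat.eq_dec n n) as [_|]; [|congruence].
  rewrite Cmod2_conj; ring.
- intros m Hm Hne.
  pose proof (roots_orthogonal N n m Hn Hm) as O; cbv zeta in O; fold t in O.
  rewrite Csum_scal; unfold c; rewrite O.
  destruct (Nat.eq_dec n m); [congruence|ring].
Qed.

(** * Bessel inequality, coefficient estimates and derivatives *)

(** The polynomial Parseval identity holds for the truncation at degree [K] on
    the circle of radius [s], where the truncation is bounded by [M] plus the
    tail of the series; then [K] tends to infinity. *)
Lemma bessel_inside f z0 r a M s N :
  expands f z0 r a -> (forall z, Cmod (z - z0) < r -> Cmod (f z) <= M) ->
  0 <= s < r -> sum_n (fun n => (Cmod (a n) * s ^ n) ^ 2) N <= M ^ 2.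
Proof.
intros Hf HM Hs.
set (g := fun n => Cmod (a n) * s ^ n).
assert (Eg : ex_series g) by (apply (expands_abs f z0 r); auto).
assert (g0 : forall n, 0 <= g n)
  by (intros n; apply Rmult_le_pos; [apply Cmod_ge_0|apply pow_le; lra]).
assert (M0 : 0 <= M).
{ eapply Rle_trans; [apply Cmod_ge_0|apply (HM z0)].
  replace (z0 - z0)%C with (RtoC 0) by ring; rewrite Cmod_0; lra. }
assert (HK : forall K, (N <= K)%nat ->
  sum_n (fun n => g n ^ 2) N <= (M + (Series g - sum_n g K)) ^ 2).
{ intros K HK.
  apply Rle_trans with (sum_n (fun n => g n ^ 2) K).
  { apply Rsum_mono; auto; intros; apply pow2_ge_0. }
  assert (P : 0 < INR (S K)) by (apply lt_0_INR; lia).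
  apply Rmult_le_reg_l with (INR (S K)); auto.
  rewrite (Rmult_comm _ ((M + _) ^ 2)).
  set (A := fun n => (a n * s ^ n)%C).
  replace (sum_n (fun n => g n ^ 2) K) with (sum_n (fun n => Cmod (A n) ^ 2) K).
  2:{ apply sum_n_ext; intros n; unfold A, g.
      rewrite Cmod_mult, Cmod_pow, Cmod_R, (Rabs_pos_eq s) by lra; reflexivity. }
  rewrite <- parseval_polynomial.
  rewrite (Rmult_comm _ (INR (S K))), <- sum_n_const; apply Rsum_le; intros k _.
  apply pow_incr; split; [apply Cmod_ge_0|].
  set (u := cis (INR k * (2 * PI / INR (S K)))).
  assert (Hu : Cmod (s * u) = s).
  { rewrite Cmod_mult, Cmod_R, Rabs_pos_eq by lra; unfold u; rewrite Cmod_cis; ring. }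
  assert (L : Cseries_to (fun n => A n * u ^ n)%C (f (z0 + s * u)%C)).
  { apply Cseries_ext with (2 := expands_at f z0 r a (s * u) Hf ltac:(lra)).
    intros n; unfold A; rewrite Cpow_mult_l; ring. }
  pose proof (Cseries_tail (fun n => A n * u ^ n)%C g (f (z0 + s * u)%C) K) as T.
  assert (HA : forall n, Cmod (A n * u ^ n) <= g n).
  { intros n; unfold A, g; rewrite !Cmod_mult, !Cmod_pow, Cmod_R, Rabs_pos_eq by lra.
    unfold u; rewrite Cmod_cis, pow1; lra. }
  specialize (T HA Eg L).
  assert (Hfz : Cmod (f (z0 + s * u)%C) <= M).
  { apply HM; replace (z0 + s * u - z0)%C with (s * u)%C by ring; lra. }
  pose proof (Cmod_triangle (Csum (fun n => A n * u ^ n)%C K - f (z0 + s * u)%C)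
                (f (z0 + s * u)%C)) as T2.
  replace (Csum (fun n => A n * u ^ n)%C K - f (z0 + s * u)%C + f (z0 + s * u)%C)%C
    with (Csum (fun n => A n * u ^ n)%C K) in T2 by ring.
  lra. }
apply Rnot_lt_le; intros Hlt.
(* Otherwise the tail after a large index is too small to bridge the gap; the
   size of [tau] comes from [(M + tau) ^ 2 <= M ^ 2 + tau * (2 * M + 1)]. *)
set (gap := sum_n (fun n => g n ^ 2) N - M ^ 2).
assert (G : 0 < gap) by (unfold gap, g; lra).
set (tau := Rmin 1 (gap / (2 * M + 2))).
assert (T0 : 0 < tau).
{ unfold tau; apply Rmin_pos; [lra|apply Rdiv_lt_0_compat; lra]. }
assert (T1 : tau <= 1) by apply Rmin_l.
assert (T2 : tau * (2 * M + 2) <= gap).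
{ assert (tau <= gap / (2 * M + 2)) by apply Rmin_r.
  apply Rle_trans with (gap / (2 * M + 2) * (2 * M + 2)).
  - apply Rmult_le_compat_r; lra.
  - right; field; lra. }
assert (Lg : is_lim_seq (sum_n g) (Series g)) by exact (Series_correct _ Eg).
apply is_lim_seq_spec in Lg.
destruct (Lg (mkposreal tau T0)) as [K HKt]; simpl in HKt.
specialize (HKt (K + N)%nat ltac:(lia)); apply Rabs_def2 in HKt.
pose proof (Rsum_le_Series g (K + N) g0 Eg).
specialize (HK (K + N)%nat ltac:(lia)).
unfold gap in *; nra.
Qed.

(** The finite sum is continuous in the radius, so the boundary case follows
    from the inner circles. *)
Lemma bessel f z0 r a M N :
  0 < r -> expands f z0 r a -> (forall z, Cmod (z - z0) < r -> Cmod (f z) <= M) ->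
  sum_n (fun n => (Cmod (a n) * r ^ n) ^ 2) N <= M ^ 2.
Proof.
intros Hr Hf HM; apply Rnot_lt_le; intros Hlt.
set (P := fun s => sum_n (fun n => (Cmod (a n) * s ^ n) ^ 2) N).
assert (HP : continuous P r).
{ unfold P; clear; induction N as [|N IH].
  - apply continuous_ext with (fun s => (Cmod (a 0%nat) * s ^ 0) ^ 2).
    { intros s; rewrite sum_O; reflexivity. }
    apply continuous_const.
  - apply continuous_ext with (fun s =>
      plus (sum_n (fun n => (Cmod (a n) * s ^ n) ^ 2) N) ((Cmod (a (S N)) * s ^ S N) ^ 2)).
    { intros s; rewrite Rsum_S; reflexivity. }
    apply (continuous_plus (V := R_NormedModule)); [exact IH|].
    apply (ex_derive_continuous (V := R_NormedModule)); auto_derive; exact I. }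
assert (L : locally (P r) (fun y => M ^ 2 < y)) by (apply open_gt; exact Hlt).
destruct (HP _ L) as [d Hd].
set (s := Rmax 0 (r - d / 2)).
pose proof (cond_pos d).
assert (Hs : 0 <= s < r) by (unfold s; split; [apply Rmax_l|apply Rmax_lub_lt; lra]).
assert (B : ball r d s).
{ change (Rabs (s - r) < d); rewrite Rabs_left by lra.
  pose proof (Rmax_r 0 (r - d / 2)); unfold s in *; lra. }
specialize (Hd s B).
pose proof (bessel_inside f z0 r a M s N Hf HM Hs); unfold P in Hd; lra.
Qed.

Lemma cauchy_estimate f z0 r a M n :
  0 < r -> expands f z0 r a -> (forall z, Cmod (z - z0) < r -> Cmod (f z) <= M) ->
  Cmod (a n) * r ^ n <= M.
Proof.
intros Hr Hf HM.
assert (M0 : 0 <= M).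
{ eapply Rle_trans; [apply Cmod_ge_0|apply (HM z0)].
  replace (z0 - z0)%C with (RtoC 0) by ring; rewrite Cmod_0; lra. }
pose proof (bessel f z0 r a M n Hr Hf HM) as B.
pose proof (Rsum_term_le (fun n => (Cmod (a n) * r ^ n) ^ 2) n n
              (fun k => pow2_ge_0 _) (le_n n)) as T; simpl in T, B.
assert (0 <= Cmod (a n) * r ^ n)
  by (apply Rmult_le_pos; [apply Cmod_ge_0|apply pow_le; lra]).
nra.
Qed.

(** The difference of the two series represents a function bounded by 0 on a
    small disk, so the coefficient estimate kills every coefficient. *)
Lemma expands_unique f g z0 r r' rho a b :
  0 < r -> 0 < r' -> 0 < rho -> expands f z0 r a -> expands g z0 r' b ->
  (forall z, Cmod (z - z0) < rho -> f z = g z) -> forall n, a n = b n.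
Proof.
intros Hr Hr' Hrho Hf Hg E n.
set (s := Rmin rho (Rmin r r')).
assert (Hs : 0 < s) by (unfold s; repeat apply Rmin_pos; auto).
assert (Hs1 : s <= rho) by apply Rmin_l.
assert (Hs2 : s <= r) by (eapply Rle_trans; [apply Rmin_r|apply Rmin_l]).
assert (Hs3 : s <= r') by (eapply Rle_trans; [apply Rmin_r|apply Rmin_r]).
assert (D : expands (fun _ => RtoC 0) z0 s (fun n => a n - b n)%C).
{ intros z Hz.
  replace (RtoC 0) with (f z - g z)%C by (rewrite E by lra; ring).
  apply Cseries_ext with
    (2 := Cseries_minus _ _ _ _ (Hf z ltac:(lra)) (Hg z ltac:(lra))).
  intros k; ring. }
pose proof (cauchy_estimate _ z0 s _ 0 n Hs D) as T.
assert (Z : Cmod (a n - b n) * s ^ n <= 0)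
  by (apply T; intros; rewrite Cmod_0; lra).
assert (0 < s ^ n) by (apply pow_lt; auto).
pose proof (Cmod_ge_0 (a n - b n)).
assert (Cmod (a n - b n) = 0) by nra.
assert (W : (a n - b n)%C = RtoC 0) by (apply Cmod_eq_0; auto).
replace (a n) with (a n - b n + b n)%C by ring; rewrite W; ring.
Qed.

(** The remainder after the linear term is at most [B * Cmod h ^ 2], since the
    series divided by its first two powers of [h] is bounded on a smaller disk. *)
Lemma expands_is_derive f z0 r a :
  0 < r -> expands f z0 r a -> is_derive (K := C_AbsRing) (V := C_NormedModule) f z0 (a 1%nat).
Proof.
intros Hr Hf.
set (s := r / 2).
set (g := fun n => Cmod (a n) * s ^ n).
assert (Eg : ex_series g) by (apply (expands_abs f z0 r); unfold s; auto; lra).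
assert (g0 : forall n, 0 <= g n)
  by (intros n; apply Rmult_le_pos; [apply Cmod_ge_0|apply pow_le; unfold s; lra]).
set (B := Series (fun n => g (S (S n))) / s ^ 2).
assert (Eg2 : ex_series (fun n => g (S (S n)))).
{ apply (ex_series_incr_1 (fun n => g (S n))), (ex_series_incr_1 g); exact Eg. }
assert (B0 : 0 <= B).
{ apply Rdiv_le_0_compat; [|apply pow_lt; unfold s; lra].
  eapply Rle_trans; [apply (g0 2%nat)|].
  pose proof (Rsum_le_Series (fun n => g (S (S n))) 0 (fun k => g0 _) Eg2) as H.
  rewrite sum_O in H; exact H. }
assert (Q : forall h, Cmod h <= s ->
   Cmod (f (z0 + h)%C - f z0 - a 1%nat * h) <= B * Cmod h ^ 2).
{ intros h Hh.
  pose proof (expands_at f z0 r a h Hf ltac:(unfold s in Hh; lra)) as L.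
  rewrite (expands_value f z0 r a Hr Hf).
  assert (L2 : Cseries_to (fun n => a (S (S n)) * h ^ (S (S n)))%C
     (f (z0 + h)%C - a 0%nat - a 1%nat * h)%C).
  { apply (Cseries_shift (fun n => a (S n) * h ^ (S n))%C).
    apply (Cseries_shift (fun n => a n * h ^ n)%C).
    replace (f (z0 + h)%C - a 0%nat - a 1%nat * h + a 1%nat * h ^ 1 + a 0%nat * h ^ 0)%C
      with (f (z0 + h)%C) by (simpl; ring).
    exact L. }
  unfold B; replace (Series (fun n => g (S (S n))) / s ^ 2 * Cmod h ^ 2)
    with (Series (fun n => Cmod h ^ 2 / s ^ 2 * g (S (S n))))
    by (rewrite Series_scal_l; field; unfold s; lra).
  apply (Cseries_bound_Series (fun n => a (S (S n)) * h ^ (S (S n)))%C); auto.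
  - intros n; unfold g; rewrite Cmod_mult, Cmod_pow.
    replace (Cmod h ^ 2 / s ^ 2 * (Cmod (a (S (S n))) * s ^ S (S n)))
      with (Cmod (a (S (S n))) * (Cmod h ^ 2 * s ^ n))
      by (simpl; field; unfold s; lra).
    apply Rmult_le_compat_l; [apply Cmod_ge_0|].
    replace (Cmod h ^ S (S n)) with (Cmod h ^ 2 * Cmod h ^ n) by (simpl; ring).
    apply Rmult_le_compat_l; [apply pow2_ge_0|].
    apply pow_incr; split; [apply Cmod_ge_0|auto].
  - apply (ex_series_scal (V := R_NormedModule) (Cmod h ^ 2 / s ^ 2)
             (fun n => g (S (S n)))); exact Eg2. }
split.
- apply (is_linear_scal_l (K := C_AbsRing) (V := C_NormedModule)).
- intros x Hx eps.
  apply (is_filter_lim_locally_unique (V := AbsRing_NormedModule C_AbsRing)) in Hx.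
  subst x.
  pose proof (cond_pos eps).
  set (d := Rmin s (eps / (B + 1))).
  assert (Hd : 0 < d).
  { unfold d; apply Rmin_pos; [unfold s; lra|apply Rdiv_lt_0_compat; lra]. }
  assert (K : forall y : C, Cmod (y - z0) < d ->
    Cmod (f y - f z0 - (y - z0) * a 1%nat) <= eps * Cmod (y - z0));
    [|exists (mkposreal d Hd); exact K].
  intros y Hy'.
  assert (D1 : d <= s) by apply Rmin_l.
  assert (D2 : d <= eps / (B + 1)) by apply Rmin_r.
  specialize (Q (y - z0)%C ltac:(lra)).
  replace (z0 + (y - z0))%C with y in Q by ring.
  rewrite (Cmult_comm (y - z0)%C).
  pose proof (Cmod_ge_0 (y - z0)).
  assert (B * Cmod (y - z0) <= eps).
  { apply Rle_trans with ((B + 1) * (eps / (B + 1))); [|right; field; lra].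
    apply Rmult_le_compat; lra. }
  eapply Rle_trans; [exact Q|].
  nra.
Qed.

Lemma expands_C_derive f z0 r a : 0 < r -> expands f z0 r a -> C_derive f z0 = a 1%nat.
Proof.
intros Hr Hf; apply is_C_derive_unique.
exact (expands_is_derive f z0 r a Hr Hf).
Qed.

(** * Taylor series on the whole unit disk *)

(** A radius [d] attached to a possible centre [z1] that serves simultaneously
    as radius of convergence and, through [/ e], as bound on [f], for all points
    of the closed disk of radius [sigma] close to [z1]. One number plays both
    roles so that a compactness argument minimising a single positive function
    applies; it holds vacuously for [z1] outside the unit disk if [d] is small. *)
Definition good_radius (f : C -> C) (sigma : R) (z1 : C) (d : R) : Prop :=
  forall z0 e, Cmod z0 <= sigma -> Cmod (z0 - z1) < 2 * d -> 0 < e <= d ->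
  exists b, expands f z0 e b /\ forall z, Cmod (z - z0) < e -> Cmod (f z) <= / e.

Lemma good_radius_exists f sigma z1 :
  analytic_on unit_disk f -> sigma < 1 -> exists d : posreal, good_radius f sigma z1 d.
Proof.
intros Hf Hs.
destruct (Rlt_le_dec (Cmod z1) 1) as [H1|H1].
- destruct (proj1 (analytic_on_expands _ _) Hf z1 H1) as (r & a & Hr & Ha).
  set (t := 3 / 4 * r).
  assert (Et : ex_series (fun n => Cmod (a n) * t ^ n))
    by (apply (expands_abs f z1 r); auto; unfold t; lra).
  set (M := Series (fun n => Cmod (a n) * t ^ n)).
  assert (HM : forall z, Cmod (z - z1) <= t -> Cmod (f z) <= M).
  { intros z Hz.
    apply (Cseries_bound_Series (fun n => a n * (z - z1) ^ n)%C); auto.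
    - intros n; rewrite Cmod_mult, Cmod_pow.
      apply Rmult_le_compat_l; [apply Cmod_ge_0|].
      apply pow_incr; split; [apply Cmod_ge_0|auto].
    - apply Ha; unfold t in Hz; lra. }
  assert (M0 : 0 <= M).
  { eapply Rle_trans; [apply Cmod_ge_0|apply (HM z1)].
    replace (z1 - z1)%C with (RtoC 0) by ring; rewrite Cmod_0; unfold t; lra. }
  set (d := Rmin (r / 4) (/ (M + 1))).
  assert (D0 : 0 < d) by (apply Rmin_pos; [lra|apply Rinv_0_lt_compat; lra]).
  assert (D1 : d <= r / 4) by apply Rmin_l.
  assert (D2 : d <= / (M + 1)) by apply Rmin_r.
  exists (mkposreal d D0); simpl; intros z0 e Hz0 Hz01 He.
  exists (fun m => taylor a m (z0 - z1)); split.
  + apply expands_radius with (r - Cmod (z0 - z1)); [lra|].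
    apply expands_recenter; auto; lra.
  + intros z Hz; apply Rle_trans with M.
    * apply HM.
      pose proof (Cmod_triangle (z - z0) (z0 - z1)) as T.
      replace (z - z0 + (z0 - z1))%C with (z - z1)%C in T by ring.
      unfold t; lra.
    * apply Rle_trans with (M + 1); [lra|].
      rewrite <- (Rinv_inv (M + 1)); apply Rinv_le_contravar; lra.
- exists (mkposreal ((1 - sigma) / 2) ltac:(lra)); simpl.
  intros z0 e Hz0 Hz01 He; exfalso.
  pose proof (Cmod_triangle z0 (- (z0 - z1))) as T.
  rewrite Cmod_opp in T.
  replace (z0 + - (z0 - z1))%C with z1 in T by ring; lra.
Qed.

Lemma Cmod_le_components (z : C) : Cmod z <= Rabs (Re z) + Rabs (Im z).
Proof.
replace z with ((Re z : C) + Ci * Im z)%C at 1.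
- eapply Rle_trans; [apply Cmod_triangle|].
  rewrite Cmod_mult, Cmod_Ci, !Cmod_R; lra.
- destruct z as [x y]; unfold RtoC, Ci, Cmult, Cplus; simpl; f_equal; ring.
Qed.

(** Compactness of the square circumscribed about the disk of radius
    [sigma]. *)
Lemma uniform_expansions f sigma :
  analytic_on unit_disk f -> sigma < 1 ->
  exists d, 0 < d /\ forall z0, Cmod z0 <= sigma ->
    exists b, expands f z0 d b /\ forall z, Cmod (z - z0) < d -> Cmod (f z) <= / d.
Proof.
intros Hf Hs.
assert (Ch : forall u v : R, { d : posreal | good_radius f sigma (u, v) d }).
{ intros u v; apply constructive_indefinite_description.
  apply good_radius_exists; auto. }
destruct (compactness_value_2d (- sigma) sigma (- sigma) sigma
            (fun u v => proj1_sig (Ch u v))) as [d Hd].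
exists d; split; [apply cond_pos|].
intros [x y] Hz; apply NNPP; intros Hn.
pose proof (re_le_Cmod (x, y)) as Hx; pose proof (im_le_Cmod (x, y)) as Hy.
unfold Re, Im in Hx, Hy; simpl in Hx, Hy.
apply (Hd x y); [apply Rabs_le_between; lra|apply Rabs_le_between; lra|].
intros (u & v & _ & _ & Hu & Hv & Hle); apply Hn.
pose proof (proj2_sig (Ch u v)) as G; cbv beta in G.
set (du := proj1_sig (Ch u v)) in *.
apply (G (x, y) d); auto.
- eapply Rle_lt_trans; [apply Cmod_le_components|].
  unfold Re, Im; simpl.
  change (Rabs (x - u) + Rabs (y - v) < 2 * du); lra.
- split; [apply cond_pos|auto].
Qed.

(** Uniqueness identifies any local expansion with the recentred one. *)
Lemma taylor_value f r a z0 m :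
  0 < r -> expands f 0 r a -> Cmod z0 < r ->
  forall e b, 0 < e -> expands f z0 e b -> taylor a m z0 = b m.
Proof.
intros Hr Hf Hz0 e b He Hb.
assert (Hz0' : Cmod (z0 - 0) < r) by (replace (z0 - 0)%C with z0 by ring; auto).
pose proof (expands_recenter f 0 r a z0 Hf Hz0') as H.
replace (z0 - 0)%C with z0 in H by ring.
apply (expands_unique f f z0 (r - Cmod z0) e 1 (fun m => taylor a m z0) b); auto; lra.
Qed.

(** Each local expansion at [z0] has coefficients at most [/ d / d ^ m] by the
    Cauchy estimate. As functions of [z0] these coefficients are the power series
    [taylor a m], so a second Cauchy estimate gives
    [binom n m * Cmod (a n) * sigma ^ (n - m) * d ^ m <= / d]. Weighting by
    [(1 / 2) ^ m] and summing over [m] reassembles a power of [sigma + d / 2]. *)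
Lemma expansion_growth f sigma d a n :
  0 < sigma -> 0 < d -> expands f 0 sigma a ->
  (forall z0, Cmod z0 <= sigma ->
    exists b, expands f z0 d b /\ forall z, Cmod (z - z0) < d -> Cmod (f z) <= / d) ->
  Cmod (a n) * (sigma + d / 2) ^ n <= 2 / d.
Proof.
intros Hs Hd Ha Hu.
assert (Habs : forall s, 0 <= s < sigma -> ex_series (fun n => Cmod (a n) * s ^ n))
  by (intros s Hs'; apply (expands_abs f 0 sigma); auto).
assert (K : forall m, (m <= n)%nat ->
  Cmod (a n) * Rbinomial_term sigma (d / 2) n m <= / d * (1 / 2) ^ m).
{ intros m Hm.
  assert (Hdm : 0 < d ^ m) by (apply pow_lt; auto).
  assert (T : Cmod (INR (binom (n - m + m) m) * a (n - m + m)%nat)%C * sigma ^ (n - m)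
              <= / d / d ^ m).
  { apply (cauchy_estimate (taylor a m) 0 sigma
             (fun k => INR (binom (k + m) m) * a (k + m)%nat)%C _ (n - m)); auto.
    - apply taylor_expands; auto.
    - intros z0; replace (z0 - 0)%C with z0 by ring; intros Hz0.
      destruct (Hu z0) as (b & Hb & HM); [lra|].
      rewrite (taylor_value f sigma a z0 m Hs Ha Hz0 d b Hd Hb).
      apply Rle_div_r; [lra|].
      apply (cauchy_estimate f z0 d b); auto. }
  rewrite Nat.sub_add in T by lia.
  rewrite Cmod_mult, Cmod_R, Rabs_pos_eq in T by apply pos_INR.
  unfold Rbinomial_term.
  replace (d / 2) with (1 / 2 * d) by field; rewrite Rpow_mult_distr.
  assert (0 < (1 / 2) ^ m) by (apply pow_lt; lra).
  apply Rle_div_r in T; [|lra].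
  replace (Cmod (a n) * (INR (binom n m) * sigma ^ (n - m) * ((1 / 2) ^ m * d ^ m)))
    with (INR (binom n m) * Cmod (a n) * sigma ^ (n - m) * d ^ m * (1 / 2) ^ m) by ring.
  apply Rmult_le_compat_r; lra. }
rewrite <- Rsum_binomial, <- Rsum_scal.
apply Rle_trans with (sum_n (fun m => / d * (1 / 2) ^ m) n); [apply Rsum_le; exact K|].
assert (G : sum_n (fun k => (1 / 2) ^ k) n = 2 - (1 / 2) ^ n).
{ clear K; induction n as [|k IH]; [rewrite sum_O; simpl; lra|].
  rewrite Rsum_S, IH; simpl; lra. }
assert (0 < (1 / 2) ^ n) by (apply pow_lt; lra).
rewrite (Rsum_scal (/ d) (fun m => (1 / 2) ^ m)), G.
replace (2 / d) with (/ d * 2) by (unfold Rdiv; ring).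
apply Rmult_le_compat_l; [left; apply Rinv_0_lt_compat; auto|lra].
Qed.

(** The coefficient growth makes the series at 0 converge beyond [sigma]. Its sum
    agrees with [f] there too: every point slightly beyond radius [sigma] lies in
    a disk around a point inside, where both functions have the same expansion. *)
Lemma expansion_extends f sigma a :
  analytic_on unit_disk f -> 0 < sigma < 1 -> expands f 0 sigma a ->
  exists sigma', sigma < sigma' /\ expands f 0 sigma' a.
Proof.
intros Hf Hs Ha.
destruct (uniform_expansions f sigma Hf) as (d & Hd & Hu); [lra|].
set (r := sigma + d / 2).
set (F := fun z => Cseries (fun n => a n * z ^ n)%C).
assert (HF : expands F 0 r a).
{ apply expands_of_abs; intros s Hs'.
  apply (ex_series_of_bounded _ (2 / d) s r); auto; [intros; apply Cmod_ge_0|].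
  intros n; apply (expansion_growth f); auto; lra. }
assert (EF : forall z, Cmod z < sigma -> f z = F z).
{ intros z Hz; replace z with (z - 0)%C in Hz by ring.
  apply (Cseries_unique _ _ _ (Ha z Hz)); apply HF; unfold r; lra. }
exists r; split; [unfold r; lra|].
intros z Hz.
replace (f z) with (F z); [apply HF; auto|].
replace (z - 0)%C with z in Hz by ring.
destruct (Rlt_le_dec (Cmod z) sigma) as [Hlt|Hge]; [symmetry; auto|].
(* a centre [z0] of modulus less than [sigma], on the ray of [z] and within
   distance [d] of it *)
set (tau := Rmax (sigma / 2) (sigma - d / 4)).
assert (T1 : 0 < tau) by (eapply Rlt_le_trans; [|apply Rmax_l]; lra).
assert (T2 : sigma - d / 4 <= tau) by apply Rmax_r.
assert (T3 : tau < sigma) by (apply Rmax_lub_lt; lra).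
set (lam := tau / Cmod z).
assert (L0 : 0 < lam) by (apply Rdiv_lt_0_compat; lra).
assert (L1 : lam * Cmod z = tau) by (unfold lam; field; lra).
assert (L2 : lam <= 1) by (apply Rle_div_l; lra).
set (z0 := (lam * z)%C).
assert (Hz0 : Cmod z0 = tau)
  by (unfold z0; rewrite Cmod_mult, Cmod_R, Rabs_pos_eq; lra).
assert (Hzz0 : Cmod (z - z0) = Cmod z - tau).
{ unfold z0; replace (z - lam * z)%C with ((1 - lam)%R * z)%C
    by (rewrite RtoC_minus; ring).
  rewrite Cmod_mult, Cmod_R, Rabs_pos_eq by lra; rewrite <- L1; ring. }
destruct (Hu z0) as (b & Hb & _); [lra|].
assert (HF0 : expands F z0 (r - tau) (fun m => taylor a m z0)).
{ rewrite <- Hz0; replace (Cmod z0) with (Cmod (z0 - 0)) by (f_equal; ring).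
  replace (fun m => taylor a m z0) with (fun m => taylor a m (z0 - 0))
    by (replace (z0 - 0)%C with z0 by ring; reflexivity).
  apply expands_recenter; auto.
  replace (z0 - 0)%C with z0 by ring; unfold r; lra. }
assert (Eb : forall n, b n = taylor a n z0).
{ apply (expands_unique f F z0 d (r - tau) (sigma - tau)); auto; try (unfold r; lra).
  intros y Hy; apply EF.
  pose proof (Cmod_triangle (y - z0) z0) as T.
  replace (y - z0 + z0)%C with y in T by ring; lra. }
apply (Cseries_unique (fun n => taylor a n z0 * (z - z0) ^ n)%C).
- apply HF0; lra.
- apply Cseries_ext with (2 := Hb z ltac:(unfold r in Hz; lra)).
  intros n; rewrite Eb; reflexivity.
Qed.

(** Taylor's theorem for functions that are analytic in the local sense, without
    integration: the supremum of the radii on which the expansion at 0 represents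
    [f] cannot be less than 1, because any such radius can be enlarged. *)
Lemma taylor_on_disk f :
  analytic_on unit_disk f -> exists a, expands f 0 1 a.
Proof.
intros Hf.
destruct (proj1 (analytic_on_expands _ _) Hf 0%R) as (r0 & a & Hr0 & Ha).
{ unfold unit_disk; rewrite Cmod_0; lra. }
exists a.
set (S := fun r => 0 < r <= 1 /\ expands f 0 r a).
assert (S0 : S (Rmin r0 1)).
{ split; [split; [apply Rmin_pos; lra|apply Rmin_r]|].
  apply expands_radius with r0; auto; apply Rmin_l. }
destruct (completeness S) as [sigma [Hub Hlub]].
- exists 1; intros r [Hr _]; lra.
- exists (Rmin r0 1); exact S0.
- assert (P0 : 0 < sigma) by (apply Rlt_le_trans with (2 := Hub _ S0); apply S0).
  assert (P1 : sigma <= 1) by (apply Hlub; intros r [Hr _]; lra).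
  assert (Es : expands f 0 sigma a).
  { intros z Hz; apply NNPP; intros Hn.
    apply (Rlt_not_le _ _ Hz), Hlub; intros r [Hr Hra].
    apply Rnot_lt_le; intros Hlt; apply Hn, Hra; auto. }
  destruct (Rlt_le_dec sigma 1) as [Hlt|Hge].
  2:{ replace 1 with sigma by lra; exact Es. }
  exfalso.
  destruct (expansion_extends f sigma a Hf (conj P0 Hlt) Es) as (s' & Hs' & Hx).
  assert (S1 : S (Rmin s' 1)).
  { split; [split; [apply Rmin_pos; lra|apply Rmin_r]|].
    apply expands_radius with s'; auto; apply Rmin_l. }
  pose proof (Hub _ S1); pose proof (Rmin_glb_lt s' 1 sigma Hs' Hlt); lra.
Qed.

(** * Operations on expansions, and logarithms *)

Lemma expands_derive f r a :
  expands f 0 r a ->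
  expands (C_derive f) 0 r (fun n => INR (S n) * a (S n))%C.
Proof.
intros Hf.
apply expands_ext with (3 := taylor_expands a r 1 (fun s => expands_abs f 0 r a s Hf)).
- intros z Hz.
  pose proof (expands_recenter f 0 r a z Hf Hz) as H.
  rewrite (expands_C_derive f z _ _ (proj2 (Rlt_0_minus _ _) Hz) H).
  f_equal; ring.
- intros n; rewrite Nat.add_1_r, binom_1; reflexivity.
Qed.

Lemma expands_mul_z f r a :
  expands f 0 r a ->
  expands (fun z => z * f z)%C 0 r (fun n => match n with O => RtoC 0 | S k => a k end).
Proof.
intros H z Hz.
replace (z * f z)%C with (z * f z + 0 * (z - 0) ^ 0)%C by (simpl; ring).
apply (Cseries_shift (fun n => match n with O => RtoC 0 | S k => a k end * (z - 0) ^ n)%C).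
apply Cseries_ext with (2 := Cseries_scal z _ _ (H z Hz)).
intros n; rewrite Cpow_S; ring.
Qed.

(** Each multiplication by [z] undoes one index shift of a differentiation, so
    [z f'] and [z ^ 2 f''] have coefficients [n a_n] and [n (n - 1) a_n]. *)
Lemma expands_euler_operator (c1 c2 : R) f r a :
  expands f 0 r a ->
  expands (fun z => f z + c1 * z * C_derive f z
                    + c2 * z ^ 2 * C_derive (C_derive f) z)%C 0 r
    (fun n => (1 + c1 * INR n + c2 * (INR n * (INR n - 1)))%R * a n)%C.
Proof.
intros H.
pose proof (expands_derive f r a H) as H1.
pose proof (expands_derive _ r _ H1) as H2.
apply expands_mul_z in H1.
apply expands_mul_z, expands_mul_z in H2.
apply (expands_ext _ _ 0 r _ _) with
  (3 := expands_plus _ _ _ _ _ _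
          (expands_plus _ _ _ _ _ _ H (expands_scal c1 _ _ _ _ H1))
          (expands_scal c2 _ _ _ _ H2)).
- intros z _; simpl; ring.
- intros [|[|n]]; rewrite ?S_INR; simpl INR;
    repeat rewrite ?RtoC_plus, ?RtoC_mult, ?RtoC_minus; ring.
Qed.

Definition conv (a b : nat -> C) (n : nat) : C := Csum (fun k => a k * b (n - k)%nat)%C n.

(** The Cauchy product, as an instance of summation by columns: the column of
    index [m] sums to [a m * z ^ m * g z]. *)
Lemma expands_mult f g r a b :
  expands f 0 r a -> expands g 0 r b ->
  expands (fun z => f z * g z)%C 0 r (conv a b).
Proof.
intros Hf Hg z Hz.
pose proof (Hf z Hz) as Sf; pose proof (Hg z Hz) as Sg.
replace (z - 0)%C with z in * by ring.
set (s := Cmod z) in *.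
assert (s0 : 0 <= s) by apply Cmod_ge_0.
assert (Ea := expands_abs f 0 r a s Hf (conj s0 Hz)).
assert (Eb := expands_abs g 0 r b s Hg (conj s0 Hz)).
set (A := fun n => Cmod (a n) * s ^ n) in *.
set (B := fun n => Cmod (b n) * s ^ n) in *.
assert (A0 : forall n, 0 <= A n)
  by (intros; apply Rmult_le_pos; [apply Cmod_ge_0|apply pow_le; auto]).
assert (B0 : forall n, 0 <= B n)
  by (intros; apply Rmult_le_pos; [apply Cmod_ge_0|apply pow_le; auto]).
set (T := fun n m => if le_dec m n then (a m * z ^ m * (b (n - m)%nat * z ^ (n - m)))%C
                     else RtoC 0).
set (G := fun n => sum_f_R0 (fun k => A k * B (n - k)%nat) n).
assert (EG : ex_series G).
{ eexists; apply is_series_mult_pos; auto; apply Series_correct; auto. }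
assert (TG : forall n M, Cmod (Csum (T n) M) <= G n).
{ intros n M; eapply Rle_trans; [apply Cmod_Csum|].
  unfold G; rewrite <- sum_n_Reals.
  assert (P : forall k, Cmod (T n k) <= if le_dec k n then A k * B (n - k)%nat else 0).
  { intros k; unfold T; destruct (le_dec k n) as [Hk|Hk].
    - unfold A, B, s; rewrite !Cmod_mult, !Cmod_pow; apply Rle_refl.
    - rewrite Cmod_0; apply Rle_refl. }
  apply Rle_trans with (sum_n (fun k => Cmod (T n k)) n).
  - destruct (Nat.le_ge_cases M n) as [H|H].
    + apply Rsum_mono; auto; intros; apply Cmod_ge_0.
    + apply Req_le; induction H as [|M H IH]; [reflexivity|].
      rewrite Rsum_S, IH; unfold T at 2; destruct (le_dec (S M) n); [lia|].
      rewrite Cmod_0; ring.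
  - apply Rsum_le; intros k Hk; specialize (P k).
    destruct (le_dec k n); [exact P|lia]. }
destruct (Cseries_abs (fun n => Csum (T n) n) G (fun n => TG n n) EG) as [l Hl].
assert (Col : forall m, Cseries_to (fun n => T n m) (a m * z ^ m * g z)%C).
{ intros m; apply (Cseries_shift_n _ m).
  - intros n H; unfold T; destruct (le_dec m n); [lia|reflexivity].
  - apply Cseries_ext with (2 := Cseries_scal (a m * z ^ m)%C _ _ Sg).
    intros k; unfold T; destruct (le_dec m (k + m)); [|lia].
    rewrite Nat.add_sub; reflexivity. }
assert (L := Cseries_columns T G _ l
   ltac:(intros n m H; unfold T; destruct (le_dec m n); [lia|reflexivity]) TG EG Col Hl).
assert (El : l = (f z * g z)%C).
{ apply (Cseries_unique _ _ _ L).
  rewrite Cmult_comm.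
  apply Cseries_ext with (2 := Cseries_scal (g z) _ _ Sf); intros n; ring. }
rewrite <- El; apply Cseries_ext with (2 := Hl).
intros n; unfold conv; rewrite Cmult_comm, <- Csum_scal; apply Csum_ext.
intros k Hk; unfold T; destruct (le_dec k n); [|lia].
replace (z ^ n)%C with (z ^ k * z ^ (n - k))%C
  by (rewrite <- Cpow_add_r; f_equal; lia).
ring.
Qed.

(** Recursion on all smaller indices, without building finite prefixes: the
    iterates of [F] on any start sequence become stationary at each index. *)
Lemma course_of_values (F : (nat -> C) -> nat -> C) :
  (forall u v n, (forall k, (k < n)%nat -> u k = v k) -> F u n = F v n) ->
  exists d, forall n, d n = F d n.
Proof.
intros HF.
set (it := fun N => Nat.iter N F (fun _ => RtoC 0)).
assert (St : forall N n, (n < N)%nat -> it (S N) n = it N n).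
{ induction N as [|N IH]; intros n Hn; [lia|].
  apply (HF (it (S N)) (it N)); intros k Hk; apply IH; lia. }
assert (St2 : forall N n, (n < N)%nat -> it N n = it (S n) n).
{ intros N n H; induction H as [|N H IH]; [reflexivity|].
  rewrite St by lia; exact IH. }
exists (fun n => it (S n) n); intros n.
change (it (S n) n) with (F (it n) n); apply HF; intros k Hk; apply St2; auto.
Qed.

Lemma formal_quotient (e p : nat -> C) :
  p 0%nat = RtoC 1 -> exists d, forall n, conv d p n = e n.
Proof.
intros Hp.
destruct (course_of_values (fun u n =>
  match n with O => e 0%nat
  | S m => (e n - Csum (fun k => u k * p (n - k)%nat) m)%C end)) as [d Hd].
- intros u v [|m] H; [reflexivity|].
  f_equal; apply Csum_ext; intros k Hk; rewrite H by lia; reflexivity.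
- exists d; intros [|m]; unfold conv.
  + rewrite Csum_O, Nat.sub_diag, Hp, Hd; ring.
  + rewrite Csum_S, Nat.sub_diag, Hp, (Hd (S m)); ring.
Qed.

Lemma Rsum_conv_le (x y : nat -> R) B N :
  (forall k, 0 <= x k) -> (forall k, sum_n y k <= B) ->
  sum_n (fun n => sum_n (fun k => x k * y (n - k)%nat) n) N <= sum_n x N * B.
Proof.
intros Hx HB.
replace (sum_n (fun n => sum_n (fun k => x k * y (n - k)%nat) n) N)
  with (sum_n (fun k => x k * sum_n y (N - k)) N).
- rewrite Rmult_comm, <- Rsum_scal; apply Rsum_le; intros k _.
  rewrite Rmult_comm; apply Rmult_le_compat_r; auto.
- induction N as [|N IH].
  + rewrite !sum_O; reflexivity.
  + rewrite (Rsum_S (fun n => sum_n _ n)), <- IH.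
    rewrite (Rsum_S (fun k => x k * sum_n y (S N - k))),
            (Rsum_S (fun k => x k * y (S N - k)%nat)), Nat.sub_diag, sum_O.
    rewrite <- Rplus_assoc; f_equal.
    rewrite <- Rsum_plus; apply Rsum_ext; intros k Hk.
    replace (S N - k)%nat with (S (N - k)) by lia; rewrite Rsum_S; ring.
Qed.

(** With [d] the coefficients of [p'/p], the quotients [d n / (n + 1)] are the
    coefficients of the formal logarithm of [p]. Dividing the recurrence for [d]
    by [n + 1] and using [k + 1 <= n + 1] inside the convolution, their sum [S]
    satisfies [S <= 1/2 + S * (1/2)]. *)
Lemma formal_log_bound (p d : nat -> C) N :
  p 0%nat = RtoC 1 -> (forall n, conv d p n = (INR (S n) * p (S n))%C) ->
  (forall n, sum_n (fun k => Cmod (p (S k))) n <= 1 / 2) ->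
  sum_n (fun n => Cmod (d n) / INR (S n)) N <= 1.
Proof.
intros Hp Hd HB.
set (x := fun n => Cmod (d n) / INR (S n)).
set (y := fun n => match n with O => 0 | S k => Cmod (p (S k)) end).
assert (HS : forall n, 0 < INR (S n)) by (intros; apply lt_0_INR; lia).
assert (x0 : forall k, 0 <= x k)
  by (intros k; apply Rdiv_le_0_compat; [apply Cmod_ge_0|apply HS]).
assert (y0 : forall k, 0 <= y k) by (intros [|k]; simpl; [lra|apply Cmod_ge_0]).
assert (yB : forall k, sum_n y k <= 1 / 2).
{ intros [|k]; [rewrite sum_O; simpl; lra|].
  rewrite Rsum_shift; specialize (HB k); simpl; simpl in HB; lra. }
assert (E : forall n, x n <= Cmod (p (S n)) + sum_n (fun k => x k * y (n - k)%nat) n).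
{ intros n; specialize (Hd n); unfold conv in Hd.
  assert (Q : Cmod (d n) <= INR (S n) * (Cmod (p (S n)) + sum_n (fun k => x k * y (n - k)%nat) n)).
  { destruct n as [|n].
    - rewrite Csum_O, Nat.sub_diag, Hp in Hd.
      replace (d 0%nat) with (INR 1 * p 1%nat)%C by (rewrite <- Hd; ring).
      rewrite Cmod_mult, Cmod_R, Rabs_pos_eq by apply pos_INR.
      rewrite sum_O; simpl; lra.
    - rewrite Csum_S, Nat.sub_diag, Hp in Hd.
      replace (d (S n)) with (INR (S (S n)) * p (S (S n))
         + - Csum (fun k => d k * p (S n - k)%nat) n)%C by (rewrite <- Hd; ring).
      eapply Rle_trans; [apply Cmod_triangle|].
      rewrite Cmod_opp, Cmod_mult, Cmod_R, Rabs_pos_eq, Rmult_plus_distr_l by apply pos_INR.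
      apply Rplus_le_compat_l.
      eapply Rle_trans; [apply Cmod_Csum|].
      rewrite Rsum_S, Nat.sub_diag; simpl (y 0%nat); rewrite Rmult_0_r, Rplus_0_r.
      rewrite <- Rsum_scal; apply Rsum_le; intros k Hk.
      rewrite Cmod_mult; replace (S n - k)%nat with (S (n - k)) by lia; simpl (y (S _)).
      rewrite <- Rmult_assoc; apply Rmult_le_compat_r; [apply Cmod_ge_0|].
      unfold x; replace (Cmod (d k)) with (INR (S k) * (Cmod (d k) / INR (S k))) at 1
        by (field; apply Rgt_not_eq, HS).
      apply Rmult_le_compat_r; [apply x0|]; apply le_INR; lia. }
  unfold x at 1; apply Rle_div_l; [apply HS|]; lra. }
pose proof (Rsum_conv_le x y (1 / 2) N x0 yB) as Cv.
assert (F : sum_n x N <= sum_n (fun k => Cmod (p (S k))) N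
   + sum_n (fun n => sum_n (fun k => x k * y (n - k)%nat) n) N).
{ rewrite <- Rsum_plus; apply Rsum_le; intros; apply E. }
specialize (HB N); lra.
Qed.

(** * The exponential along rays *)

Lemma is_derive_C_eps (f : C -> C) (z0 l : C) :
  is_derive (K := C_AbsRing) (V := C_NormedModule) f z0 l ->
  forall eps, 0 < eps -> exists d, 0 < d /\
    forall y : C, Cmod (y - z0) < d ->
      Cmod (f y - f z0 - (y - z0) * l) <= eps * Cmod (y - z0).
Proof.
intros [_ H] eps He.
destruct (H z0 (fun P HP => HP) (mkposreal eps He)) as [d Hd].
exists d; split; [apply cond_pos|]; intros y Hy; exact (Hd y Hy).
Qed.

(** [L] is meant to be the real or the imaginary part. *)
Lemma is_derive_ray (L : C -> R) (f : C -> C) (z : C) (t : R) (l : C) :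
  (forall u v, L (u - v)%C = L u - L v) -> (forall (c : R) u, L (c * u)%C = c * L u) ->
  (forall u, Rabs (L u) <= Cmod u) ->
  is_derive (K := C_AbsRing) (V := C_NormedModule) f (t * z)%C l ->
  is_derive (K := R_AbsRing) (V := R_NormedModule) (fun s => L (f (s * z)%C)) t (L (z * l)%C).
Proof.
intros Lm Ls Lb H; apply is_derive_Reals; intros eps He.
pose proof (Cmod_ge_0 z).
set (e := eps / (2 * (Cmod z + 1))).
assert (He' : 0 < e) by (apply Rdiv_lt_0_compat; lra).
destruct (is_derive_C_eps f _ l H e He') as (d & Hd & Q).
assert (Hd' : 0 < d / (Cmod z + 1)) by (apply Rdiv_lt_0_compat; lra).
exists (mkposreal _ Hd'); simpl; intros h Hh0 Hh.
specialize (Q ((t + h)%R * z)%C).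
replace ((t + h)%R * z - t * z)%C with (h * z)%C in Q by (rewrite RtoC_plus; ring).
rewrite Cmod_mult, Cmod_R in Q.
assert (Ha : 0 < Rabs h) by (apply Rabs_pos_lt; auto).
assert (Hhz : Rabs h * Cmod z < d).
{ apply Rle_lt_trans with (Rabs h * (Cmod z + 1)); [nra|].
  apply Rlt_div_r; [lra|exact Hh]. }
specialize (Q Hhz).
replace ((L (f ((t + h)%R * z)%C) - L (f (t * z)%C)) / h - L (z * l)%C)
  with (/ h * L (f ((t + h)%R * z) - f (t * z) - h * z * l)%C).
2:{ rewrite !Lm; replace (h * z * l)%C with (h * (z * l))%C by ring.
    rewrite Ls; field; auto. }
rewrite Rabs_mult, Rabs_inv.
apply Rmult_lt_reg_l with (Rabs h); auto.
rewrite <- Rmult_assoc, Rinv_r, Rmult_1_l by lra.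
eapply Rle_lt_trans; [apply Lb|].
eapply Rle_lt_trans; [exact Q|].
replace (e * (Rabs h * Cmod z)) with (Rabs h * (e * Cmod z)) by ring.
apply Rmult_lt_compat_l; auto.
apply Rle_lt_trans with (e * (Cmod z + 1)); [nra|].
unfold e; replace (eps / (2 * (Cmod z + 1)) * (Cmod z + 1)) with (eps / 2)
  by (field; lra); lra.
Qed.

(** With [P = X + iY] and [W = A + iB], the hypothesis says [P' = P W'], so
    [P e^(-W)] is constant; [G1] and [G2] are its real and imaginary parts. *)
Lemma exp_of_log_derivative (X Y A B dA dB : R -> R) :
  (forall t, 0 <= t <= 1 -> is_derive A t (dA t) /\ is_derive B t (dB t) /\
     is_derive X t (X t * dA t - Y t * dB t) /\
     is_derive Y t (X t * dB t + Y t * dA t)) ->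
  X 0 = 1 -> Y 0 = 0 -> A 0 = 0 -> B 0 = 0 ->
  X 1 = exp (A 1) * cos (B 1) /\ Y 1 = exp (A 1) * sin (B 1).
Proof.
intros H X0 Y0 A0 B0.
set (G1 := fun t => exp (- A t) * (X t * cos (B t) + Y t * sin (B t))).
set (G2 := fun t => exp (- A t) * (Y t * cos (B t) - X t * sin (B t))).
assert (DE : forall (f : R -> R) (l t : R), is_derive f t l -> Derive (fun x : R => f x) t = l)
  by (intros; apply is_derive_unique; assumption).
assert (E1 : G1 0 = G1 1).
{ apply (eq_is_derive (V := R_NormedModule)); [|lra]; intros t Ht.
  destruct (H t Ht) as (HA & HB & HX & HY).
  unfold G1; auto_derive.
  - repeat split; eexists; eassumption.
  - change zero with 0.
    rewrite (DE A _ t HA), (DE B _ t HB), (DE X _ t HX), (DE Y _ t HY); ring. }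
assert (E2 : G2 0 = G2 1).
{ apply (eq_is_derive (V := R_NormedModule)); [|lra]; intros t Ht.
  destruct (H t Ht) as (HA & HB & HX & HY).
  unfold G2; auto_derive.
  - repeat split; eexists; eassumption.
  - change zero with 0.
    rewrite (DE A _ t HA), (DE B _ t HB), (DE X _ t HX), (DE Y _ t HY); ring. }
unfold G1, G2 in *; rewrite X0, Y0, A0, B0, Ropp_0, exp_0, cos_0, sin_0 in *.
pose proof (sin2_cos2 (B 1)) as SC; unfold Rsqr in SC.
assert (P : exp (A 1) * exp (- A 1) = 1)
  by (rewrite <- exp_plus, Rplus_opp_r; apply exp_0).
set (c := cos (B 1)) in *; set (s := sin (B 1)) in *.
set (x := X 1) in *; set (y := Y 1) in *; set (u := exp (A 1)) in *; set (v := exp (- A 1)) in *.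
assert (F1 : x * c + y * s = u).
{ replace (x * c + y * s) with (u * v * (x * c + y * s)) by (rewrite P; ring).
  rewrite Rmult_assoc, <- E1; ring. }
assert (F2 : y * c - x * s = 0).
{ replace (y * c - x * s) with (u * v * (y * c - x * s)) by (rewrite P; ring).
  rewrite Rmult_assoc, <- E2; ring. }
(* [x + iy] is recovered from its rotation by the angle [- B 1] *)
split.
- replace x with (x * (s * s + c * c)) by (rewrite SC; ring).
  replace (x * (s * s + c * c)) with ((x * c + y * s) * c - (y * c - x * s) * s) by ring.
  rewrite F1, F2; ring.
- replace y with (y * (s * s + c * c)) by (rewrite SC; ring).
  replace (y * (s * s + c * c)) with ((x * c + y * s) * s + (y * c - x * s) * c) by ring.
  rewrite F1, F2; ring.
Qed.

(** The logarithmic derivative determines [p] along every ray from 0. *)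
Lemma Cexp_of_log_derivative p w a b :
  expands p 0 1 a -> expands w 0 1 b -> p 0%R = RtoC 1 -> w 0%R = RtoC 0 ->
  (forall z, unit_disk z -> C_derive p z = (C_derive w z * p z)%C) ->
  forall z, unit_disk z -> p z = Cexp (w z).
Proof.
intros Hp Hw Hp0 Hw0 Hlog z Hz.
assert (Dz : forall f c, expands f 0 1 c -> forall t : R, 0 <= t <= 1 ->
  is_derive (K := C_AbsRing) (V := C_NormedModule) f (t * z)%C (C_derive f (t * z)%C)).
{ intros f c Hf t Ht.
  assert (Htz : Cmod (t * z - 0) < 1).
  { replace (t * z - 0)%C with (t * z)%C by ring.
    rewrite Cmod_mult, Cmod_R, Rabs_pos_eq by lra.
    unfold unit_disk in Hz; pose proof (Cmod_ge_0 z); nra. }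
  pose proof (expands_recenter f 0 1 c _ Hf Htz) as R.
  rewrite (expands_C_derive _ _ _ _ (proj2 (Rlt_0_minus _ _) Htz) R).
  exact (expands_is_derive _ _ _ _ (proj2 (Rlt_0_minus _ _) Htz) R). }
assert (RE : forall f c, expands f 0 1 c -> forall t : R, 0 <= t <= 1 ->
  is_derive (fun s : R => Re (f (s * z)%C)) t (Re (z * C_derive f (t * z))%C)).
{ intros f c Hf t Ht; apply is_derive_ray; auto using re_le_Cmod.
  - intros k u; unfold Re, Im, Cmult, RtoC; simpl; ring.
  - apply (Dz f c); auto. }
assert (IM : forall f c, expands f 0 1 c -> forall t : R, 0 <= t <= 1 ->
  is_derive (fun s : R => Im (f (s * z)%C)) t (Im (z * C_derive f (t * z))%C)).
{ intros f c Hf t Ht; apply is_derive_ray; auto using im_le_Cmod.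
  - intros k u; unfold Re, Im, Cmult, RtoC; simpl; ring.
  - apply (Dz f c); auto. }
assert (Z0 : (0%R * z)%C = RtoC 0) by ring.
assert (Z1 : (1%R * z)%C = z) by ring.
destruct (exp_of_log_derivative
  (fun s => Re (p (s * z)%C)) (fun s => Im (p (s * z)%C))
  (fun s => Re (w (s * z)%C)) (fun s => Im (w (s * z)%C))
  (fun t => Re (z * C_derive w (t * z))%C) (fun t => Im (z * C_derive w (t * z))%C))
  as [E1 E2]; rewrite ?Z0, ?Z1, ?Hp0, ?Hw0; try reflexivity.
- intros t Ht.
  assert (Htz : unit_disk (t * z)%C).
  { unfold unit_disk in *; rewrite Cmod_mult, Cmod_R, Rabs_pos_eq by lra.
    pose proof (Cmod_ge_0 z); nra. }
  split; [|split; [|split]].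
  + apply (RE w b); auto.
  + apply (IM w b); auto.
  + replace (_ - _) with (Re (z * C_derive p (t * z))%C); [apply (RE p a); auto|].
    rewrite Hlog by auto; unfold Re, Im, Cmult; simpl; ring.
  + replace (_ + _) with (Im (z * C_derive p (t * z))%C); [apply (IM p a); auto|].
    rewrite Hlog by auto; unfold Re, Im, Cmult; simpl; ring.
- rewrite Z1 in E1, E2; unfold Cexp.
  rewrite <- E1, <- E2; apply surjective_pairing.
Qed.

(** * The subordination *)

(** The square of the root has modulus at most 2. *)
Lemma crescent_bounded z : unit_disk z -> Cmod (z + Csqrt (1 + z ^ 2))%C <= 1 + sqrt 2.
Proof.
unfold unit_disk; intros Hz.
eapply Rle_trans; [apply Cmod_triangle|].
apply Rplus_le_compat; [lra|].
rewrite <- (sqrt_pow2 (Cmod (Csqrt _))) by apply Cmod_ge_0.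
apply sqrt_le_1_alt.
rewrite <- Cmod_pow, Csqrt_sqr.
eapply Rle_trans; [apply Cmod_triangle|].
rewrite Cmod_1, Cmod_pow; pose proof (Cmod_ge_0 z); nra.
Qed.

Lemma Rsum_inv_squares_le n : sum_n (fun k => / INR (S k) ^ 2) n <= 2 - / INR (S n).
Proof.
induction n as [|n IH].
- rewrite sum_O; simpl; lra.
- rewrite Rsum_S, (S_INR (S n)).
  assert (H : 1 <= INR (S n)) by (apply (le_INR 1); lia).
  set (x := INR (S n)) in *.
  assert (/ (x + 1) ^ 2 <= / x - / (x + 1)); [|lra].
  replace (/ x - / (x + 1)) with (/ (x * (x + 1))) by (field; lra).
  apply Rinv_le_contravar; nra.
Qed.

(** Since [e > 2], the second alternative contradicts positivity and the first
    one forces [gamma1 > 4 + 2 + 2]. *)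
Lemma gamma1_large (gamma1 gamma2 : R) :
  0 < gamma1 -> 0 < gamma2 ->
  gamma1 - gamma2 - exp 1 * (exp 1 + 1) >= sqrt 2 * exp 1 \/
  1 - exp 1 * (1 + gamma1 + gamma2) >= sqrt 2 -> 8 <= gamma1.
Proof.
intros H1 H2 H.
assert (E : 2 < exp 1) by (pose proof (exp_ineq1 1); lra).
assert (S : 1 <= sqrt 2) by (rewrite <- sqrt_1 at 1; apply sqrt_le_1_alt; lra).
destruct H as [H|H]; nra.
Qed.

(** The multiplier of [a n] is at least [8 n], so the [n]-th term is at most
    [B / (8 n) <= (B ^ 2 + 1 / n ^ 2) / 16] with [B] the modulus of the
    [n]-th coefficient of the bounded function; the squares [B ^ 2] sum to at most
    6 and the inverse squares to at most 2. *)
Lemma coefficient_sum_le (gamma1 gamma2 : R) (a : nat -> C) N :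
  8 <= gamma1 -> 0 < gamma2 ->
  (forall n, sum_n (fun k => Cmod ((1 + gamma1 * INR k + gamma2 * (INR k * (INR k - 1)))%R
                             * a k)%C ^ 2) n <= (1 + sqrt 2) ^ 2) ->
  sum_n (fun k => Cmod (a (S k))) N <= 1 / 2.
Proof.
intros H1 H2 HB.
set (b := fun k => Cmod ((1 + gamma1 * INR k + gamma2 * (INR k * (INR k - 1)))%R * a k)%C).
assert (T : forall k, Cmod (a (S k)) <= 1 / 16 * (b (S k) ^ 2 + / INR (S k) ^ 2)).
{ intros k; assert (Hk : 1 <= INR (S k)) by (apply (le_INR 1); lia).
  unfold b; set (x := INR (S k)) in *.
  set (c := 1 + gamma1 * x + gamma2 * (x * (x - 1))).
  assert (Hc : 8 * x <= c).
  { assert (0 <= gamma2 * (x * (x - 1))) by (repeat apply Rmult_le_pos; lra).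
    assert (8 * x <= gamma1 * x) by (apply Rmult_le_compat_r; lra).
    unfold c; lra. }
  rewrite Cmod_mult, Cmod_R, Rabs_pos_eq by lra.
  pose proof (Cmod_ge_0 (a (S k))).
  set (m := Cmod (a (S k))) in *.
  assert (8 * x * m <= c * m) by (apply Rmult_le_compat_r; auto).
  assert (Q : (8 * x * m) ^ 2 <= (c * m) ^ 2) by (apply pow_incr; split; nra).
  assert (P : 0 <= (8 * x * m - / x) ^ 2) by apply pow2_ge_0.
  (* expanding this square is the inequality of the two means *)
  replace ((8 * x * m - / x) ^ 2) with ((8 * x * m) ^ 2 - 16 * m + / x ^ 2) in P
    by (field; lra).
  lra. }
eapply Rle_trans; [apply Rsum_le; intros; apply T|].
rewrite (Rsum_scal (1 / 16) (fun k => b (S k) ^ 2 + / INR (S k) ^ 2)).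
rewrite Rsum_plus.
pose proof (Rsum_inv_squares_le N).
assert (0 < / INR (S N)) by (apply Rinv_0_lt_compat, lt_0_INR; lia).
pose proof (HB (S N)) as B; change (sum_n (fun k => b k ^ 2) (S N) <= (1 + sqrt 2) ^ 2) in B.
rewrite Rsum_shift in B.
pose proof (pow2_ge_0 (b 0%nat)).
assert (S2 : sqrt 2 * sqrt 2 = 2) by (apply sqrt_sqrt; lra).
assert (S0 : 0 <= sqrt 2) by apply sqrt_pos.
assert (sqrt 2 <= 3 / 2) by nra.
nra.
Qed.

(** The candidate for the subordinating function is the formal logarithm [w]
    of the series of [p]. The moduli of its coefficients sum to at most 1 and its
    constant term is 0, so the series converges on the disk and satisfies
    [Cmod (w z) <= Cmod z] there; comparing logarithmic derivatives gives
    [p = e ^ w]. *)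
Lemma small_coefficients_log p a :
  expands p 0 1 a -> p 0%R = RtoC 1 ->
  (forall n, sum_n (fun k => Cmod (a (S k))) n <= 1 / 2) ->
  subordinate p Cexp.
Proof.
intros Hp Hp0 HB.
assert (Ha0 : a 0%nat = RtoC 1)
  by (rewrite <- Hp0; symmetry; apply (expands_value p _ 1); auto; lra).
destruct (formal_quotient (fun n => INR (S n) * a (S n))%C a Ha0) as [d Hd].
pose proof (fun N => formal_log_bound a d N Ha0 Hd HB) as Bd.
(* [d] is the series of [p'/p], and [b] its antiderivative *)
set (b := fun n => match n with O => RtoC 0 | S k => (/ INR (S k) * d k)%C end).
assert (HS : forall n, 0 < INR (S n)) by (intros; apply lt_0_INR; lia).
assert (Eb : forall k, Cmod (b (S k)) = Cmod (d k) / INR (S k)).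
{ intros k; unfold b; rewrite Cmod_mult, <- RtoC_inv, Cmod_R, Rabs_pos_eq.
  - unfold Rdiv; ring.
  - left; apply Rinv_0_lt_compat, HS.
  - apply Rgt_not_eq, HS. }
assert (Bb : forall n, sum_n (fun k => Cmod (b k)) n <= 1).
{ intros [|n].
  - rewrite sum_O; simpl; rewrite Cmod_0; lra.
  - rewrite Rsum_shift; simpl (b 0%nat); rewrite Cmod_0, Rplus_0_l.
    rewrite (Rsum_ext _ (fun k => Cmod (d k) / INR (S k))) by (intros; apply Eb).
    apply Bd. }
set (w := fun z => Cseries (fun n => b n * z ^ n)%C).
assert (Hw : expands w 0 1 b).
{ apply expands_of_abs; intros s Hs.
  apply (ex_series_of_bounded _ 1 s 1); auto; [intros; apply Cmod_ge_0|].
  intros n; rewrite pow1, Rmult_1_r.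
  eapply Rle_trans; [|apply (Bb n)].
  apply (Rsum_term_le (fun k => Cmod (b k))); auto; intros; apply Cmod_ge_0. }
assert (Hw0 : w 0%R = RtoC 0) by (apply (expands_value w 0 1 b); auto; lra).
assert (Hle : forall z, unit_disk z -> Cmod (w z) <= Cmod z).
{ intros z Hz; unfold unit_disk in Hz.
  pose proof (expands_at w 0 1 b z Hw Hz) as L.
  rewrite Cplus_0_l in L.
  apply (Cseries_bound _ _ _ L); exists 0%nat; intros n _.
  eapply Rle_trans; [apply Cmod_Csum|].
  apply Rle_trans with (Cmod z * sum_n (fun k => Cmod (b k)) n).
  - rewrite <- Rsum_scal; apply Rsum_le; intros [|k] _.
    + simpl; rewrite Cmult_0_l, Cmod_0; lra.
    + rewrite Cmod_mult, Cmod_pow, Rmult_comm.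
      apply Rmult_le_compat_r; [apply Cmod_ge_0|].
      pose proof (Cmod_ge_0 z).
      assert (Cmod z ^ k <= 1) by (rewrite <- (pow1 k); apply pow_incr; lra).
      rewrite <- tech_pow_Rmult; nra.
  - rewrite <- (Rmult_1_r (Cmod z)) at 2.
    apply Rmult_le_compat_l; [apply Cmod_ge_0|apply Bb]. }
exists w; repeat split; auto.
- apply analytic_on_expands; intros z Hz.
  exists (1 - Cmod (z - 0)), (fun m => taylor b m (z - 0)).
  unfold unit_disk in Hz.
  replace (Cmod z) with (Cmod (z - 0)) in Hz by (f_equal; ring).
  split; [lra|]; apply expands_recenter; auto.
- intros z Hz; unfold unit_disk in *; specialize (Hle z Hz); lra.
- apply (Cexp_of_log_derivative p w a b); auto.
  intros z Hz; unfold unit_disk in Hz.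
  replace z with (z - 0)%C in Hz by ring.
  apply (Cseries_unique _ _ _ (expands_derive p 1 a Hp z Hz)).
  apply Cseries_ext with
    (2 := expands_mult _ _ 1 _ _ (expands_derive w 1 b Hw) Hp z Hz).
  intros n; rewrite <- Hd; f_equal; unfold conv; apply Csum_ext; intros k _.
  unfold b; f_equal; field.
  intros E; apply RtoC_inj in E; revert E; apply Rgt_not_eq, HS.
Qed.

Theorem theorem3p3 (gamma1 gamma2 : R) (p : C -> C)
  (hgamma1 : 0 < gamma1) (hgamma2 : 0 < gamma2)
  (hgamma :
     gamma1 - gamma2 - exp 1 * (exp 1 + 1) >= sqrt 2 * exp 1 \/
     1 - exp 1 * (1 + gamma1 + gamma2) >= sqrt 2)
  (hp : analytic_on unit_disk p) (hp0 : p 0 = 1)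
  (hsub :
     subordinate
       (fun z : C => p z + gamma1 * z * C_derive p z
                     + gamma2 * z ^ 2 * C_derive (C_derive p) z)%C
       (fun z : C => z + Csqrt (1 + z ^ 2))%C) :
  subordinate p Cexp.
Proof.
destruct (taylor_on_disk p hp) as [a Ha].
apply (small_coefficients_log p a Ha hp0); intros N.
apply (coefficient_sum_le gamma1 gamma2).
- apply (gamma1_large gamma1 gamma2); auto.
- exact hgamma2.
- intros n.
  destruct hsub as (w & _ & Hw & _ & _ & Hh).
  pose proof (bessel _ 0 1 _ (1 + sqrt 2) n Rlt_0_1
    (expands_euler_operator gamma1 gamma2 p 1 a Ha)) as B.
  eapply Rle_trans; [|apply B].
  + apply Rsum_le; intros k _; rewrite pow1, Rmult_1_r; apply Rle_refl.
  + intros z Hz; replace (z - 0)%C with z in Hz by ring.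
    rewrite Hh by exact Hz; apply crescent_bounded, Hw, Hz.
Qed.
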